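(* Let $p\in(0,1)$ and let $\gamma'_p$ be the specification defined below. Let $l,r,L,R\in\mathbb{Z}$ with $l\le r$, $L<l-1$ and $r+1<R$, and set $n=\min\{l-L,R-r\}$ and $$s([l,r],[L,R])=\sup_{\substack{\omega',\eta'\in\Omega'\\ \omega'_{[L,R]}=\eta'_{[L,R]}}}\big|\gamma'_{p,[l,r]}(\omega'_{[l,r]}\mid\omega'_{[l,r]^c})-\gamma'_{p,[l,r]}(\omega'_{[l,r]}\mid\eta'_{[l,r]^c})\big|.$$ Then $$A_-\,b_-^{\,r-l+1}\,|a|^n\ \le\ s([l,r],[L,R])\ \le\ A_+\,b_+^{\,r-l+1}\,|a|^n,$$ where $a=\lambda_r/\lambda_{PF}\in(-1,0)$, $b_-=p$, $A_-=\tfrac16\sqrt{1-p}$, $b_+=\max\{p,\lambda_{PF}\}\in(0,1)$ and $A_+=24/(1-p)^2$.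
   Context: Fix $p\in(0,1)$. Let $\Omega=\{0,1\}^{\mathbb{Z}}$ with product $\sigma$-algebra $\mathscr F$, and $\mu_p=\mathrm{Ber}(p)^{\otimes\mathbb{Z}}$. Define $T:\Omega\to\Omega$ by $(T\omega)_i=\omega_i\big(1-(1-\omega_{i-1})(1-\omega_{i+1})\big)$. Let $\Omega'=T(\Omega)$ (configurations in which every occupied site has an occupied neighbour), $\mathscr F'=\mathscr F\cap\Omega'$, and $\mu'_p=\mu_p\circ T^{-1}$ (the TBF). For $\omega\in\Omega$ and $\Delta\subset\mathbb{Z}$, $\omega_\Delta$ is the restriction to $\Delta$ and $\xi_\Lambda\eta_{\Lambda^c}$ denotes concatenation. Transfer matrix: $Q$ is the $2\times2$ matrix indexed by $\{0,1\}$ with $Q(0,0)=1-p$, $Q(0,1)=Q(1,0)=\sqrt{p(1-p)}$, $Q(1,1)=0$; its eigenvalues are $\lambda_{PF}=\tfrac12\big(1-p+\sqrt{(1-p)(3p+1)}\big)\in(0,1)$ and $\lambda_r=\tfrac12\big(1-p-\sqrt{(1-p)(3p+1)}\big)\in(-\tfrac13,0)$. Geometry: for $A\subset\mathbb{Z}$, $\partial_+A=\{j\notin A: |j-i|=1\text{ for some }i\in A\}$ and $\bar A=A\cup\partial_+A$. For $\omega'\in\Omega'$ let $\Theta(\omega')=\{x:\omega'_x=1\}$, $\bar\Theta=\Theta\cup\partial_+\Theta$, and $\mathscr U(\omega')$ the set of connected components (maximal integer intervals, possibly infinite) of $\mathbb{Z}\setminus\bar\Theta$. For finite $\Lambda$,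 $\mathscr U_\Lambda(\omega')=\{U\in\mathscr U(\omega'):\mathrm{dist}(\bar\Lambda,U)\le1\}$, $V_-=[\min\bar\Lambda,+\infty)$, $V_+=(-\infty,\max\bar\Lambda]$. For $U\in\mathscr U_\Lambda(\omega')$ set $Z(U)=(1-p)^{-1}Q^{|U|+1}(0,0)$ if $U$ is finite; $Z(U)=(1-p)^{-1}\lambda_{PF}^{|U\cap V_-|}$ if $U$ is infinite with $\sup U<\infty$; $Z(U)=(1-p)^{-1}\lambda_{PF}^{|U\cap V_+|}$ if $U$ is infinite with $\inf U>-\infty$; and $Z(U)=(1-p)^{-1}D\,\lambda_{PF}^{|V_-\cap V_+|}$ if $U=\mathbb{Z}$, where $D=(1-p)(\lambda_{PF}+2p)/\lambda_{PF}^3$. The specification $\gamma'_p=(\gamma'_{p,\Lambda})_{\Lambda\Subset\mathbb{Z}}$ on $(\Omega',\mathscr F')$ (for which $\mu'_p$ is a Gibbs measure) is given by $\gamma'_{p,\Lambda}(\omega'_\Lambda\mid\omega'_{\Lambda^c})=Z_\Lambda(\omega'_{\Lambda^c})^{-1}p^{|\Theta\cap\bar\Lambda|}(1-p)^{|\partial_+\Theta\cap\bar\Lambda|}\prod_{U\in\mathscr U_\Lambda(\omega')}Z(U)$ with $\Theta=\Theta(\omega')$, where $Z_\Lambda(\omega'_{\Lambda^c})$ normalizes this to a probability distribution over $\{\xi_\Lambda:\xi_\Lambda\omega'_{\Lambda^c}\in\Omega'\}$. *)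

(* Defs.v *)
From mathcomp Require Import all_boot all_order all_algebra.
From mathcomp Require Import all_classical all_reals.
Set Implicit Arguments. Unset Strict Implicit. Unset Printing Implicit Defensive.
Import Order.TTheory GRing.Theory Num.Theory.
Local Open Scope ring_scope.

Definition config := int -> bool.

Definition Tmap (w : config) : config :=
  fun i => w i && (w (i - 1) || w (i + 1)).

Definition Omega' (w : config) : Prop := exists w0 : config, w = Tmap w0.

Section Transfer.
Variable R : realType.
Variable p : R.
Definition Qmat : 'M[R]_2 :=
  \matrix_(i < 2, j < 2)
    (if (i == 0%N :> nat) && (j == 0%N :> nat) then 1 - p
     else if (i == 1%N :> nat) && (j == 1%N :> nat) then 0
     else Num.sqrt (p * (1 - p))).
Definition lamPF : R := (1 - p + Num.sqrt ((1 - p) * (3 * p + 1))) / 2.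
Definition lamr : R := (1 - p - Num.sqrt ((1 - p) * (3 * p + 1))) / 2.
Definition Dconst : R := (1 - p) * (lamPF + 2 * p) / lamPF ^+ 3.
End Transfer.

Definition window (a b : int) : seq int :=
  [seq a + (i%:Z) | i <- iota 0 (absz (b - a + 1))].

(* x belongs to the complement of bar Theta(w) = Theta u d_+ Theta *)
Definition free (w : config) (x : int) : bool :=
  ~~ w (x - 1) && ~~ w x && ~~ w (x + 1).

Definition bdry (w : config) (x : int) : bool :=
  ~~ w x && (w (x - 1) || w (x + 1)).

(* left / right endpoints of the component of Z \ bar Theta containing x
   (None = the component is unbounded on that side). *)
Definition lend (w : config) (x : int) : option int :=
  match pselect (exists a : int, a <= x /\ ~~ free w (a - 1) /\
                   forall y : int, a <= y <= x -> free w y) with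
  | left H => Some (proj1_sig (cid H))
  | right _ => None
  end.
Definition rend (w : config) (x : int) : option int :=
  match pselect (exists b : int, x <= b /\ ~~ free w (b + 1) /\
                   forall y : int, x <= y <= b -> free w y) with
  | left H => Some (proj1_sig (cid H))
  | right _ => None
  end.

(* Z(U) for the component U with endpoints (oa, ob), Lambda = [l, r],
   so bar Lambda = [l-1, r+1], V_- = [l-1, +oo), V_+ = (-oo, r+1]. *)
Definition ZU (R : realType) (p : R) (l r : int) (oa ob : option int) : R :=
  match oa, ob with
  | Some a, Some b => (1 - p)^-1 * ((Qmat p) ^+ (absz (b - a + 2))) 0 0
  | None, Some b => (1 - p)^-1 * lamPF p ^+ (absz (Num.max 0 (b - (l - 1) + 1)))
  | Some a, None => (1 - p)^-1 * lamPF p ^+ (absz (Num.max 0 ((r + 1) - a + 1)))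
  | None, None => (1 - p)^-1 * Dconst p * lamPF p ^+ (absz ((r + 1) - (l - 1) + 1))
  end.

(* unnormalised weight of a configuration w for Lambda = [l, r].
   The components U with dist(bar Lambda, U) <= 1 are exactly those meeting
   [l-2, r+2]; each is indexed by its leftmost point in [l-2, r+2]. *)
Definition weight (R : realType) (p : R) (l r : int) (w : config) : R :=
  p ^+ count (fun x => w x) (window (l - 1) (r + 1)) *
  (1 - p) ^+ count (bdry w) (window (l - 1) (r + 1)) *
  \prod_(x <- window (l - 2) (r + 2) |
          free w x && ((x == l - 2) || ~~ free w (x - 1)))
     ZU p l r (lend w x) (rend w x).

Definition glue (l r : int) (xi eta : config) : config :=
  fun x => if (l <= x) && (x <= r) then xi x else eta x.

Definition ffconf (l r : int) (xi : {ffun 'I_((absz (r - l + 1))) -> bool}) : config :=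
  fun x => if insub ((absz (x - l))) is Some i then xi i else false.
Arguments ffconf : clear implicits.

Definition gammaI (R : realType) (p : R) (l r : int) (w : config) : R :=
  let Zl := \sum_(xi : {ffun 'I_((absz (r - l + 1))) -> bool} |
                  `[< Omega' (glue l r (ffconf l r xi) w) >])
              weight p l r (glue l r (ffconf l r xi) w) in
  if `[< Omega' w >] then weight p l r w / Zl else 0.

Definition sdep (R : realType) (p : R) (l r L Rb : int) : R :=
  sup [set d : R | exists w e : config, Omega' w /\ Omega' e /\
        (forall x : int, L <= x <= Rb -> w x = e x) /\
        d = `| gammaI p l r w - gammaI p l r (glue l r w e) |].

(* Main.v *)
(** Two configurations that agree on [L, R] differ, as boundary conditions for
    [l, r], only through the empty gaps that reach beyond [L] or [R].  A gap of
    [k] zeros next to the window, followed inside by [c] further zeros, weighs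
    [lam^(k+c) - rho^(k+c)], i.e. up to a constant [lam^c - t rho^c] with
    [t = a^k] ([t = 0] for an infinite gap).  Hence each weight, and their sum,
    is affine in [t], of the form [F - t G] with [|G| <= F], and a change of [t]
    of size at most [2 |a|^n] changes a conditional probability by
    [O(|a|^n)] times that probability at [t = 0].  The latter is at most
    a constant times [max(p, lam)^N]: each weight is at most that, and the sum
    of all weights is bounded below by a fixed point of the transfer recursion.
    Changing the left gap first and the right one afterwards (by reflection)
    gives the upper bound.  For the lower bound the window and its right side are
    fully occupied, which makes the sum of weights explicit. *)
Require Import Defs.
From mathcomp Require Import all_boot all_order all_algebra.
From mathcomp Require Import all_classical all_reals.
From mathcomp Require Import zify ring lra.
Import Defs Order.TTheory GRing.Theory Num.Theory.
Set Implicit Arguments. Unset Strict Implicit. Unset Printing Implicit Defensive.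
Local Open Scope ring_scope.

(** The weight is not a product over sites: the factor of a component depends on its whole length,
    and a one is legal only if it has a neighbour. The window is therefore scanned by an automaton
    that withholds the factor of a run of zeros until the run is closed, and that remembers whether
    the last one still needs a successor. The gaps leaving the window contribute factors such as
    [lam^k / (lam - rho)], common to all fillings of the window; these cancel in the quotient, which
    puts finite and infinite gaps into one family with parameter [t]. The estimate has to be uniform
    in what lies to the right of the window. There the sum of weights may become small, so a lower
    bound for it is of use only together with an upper bound for single weights that becomes small
    in the same way. Affinity in [t] is used only when the sites from [L] up to the window are
    empty. Otherwise a one among them screens the window and the probability does not change at all.
    In the remaining case the gap has at least two sites, so [|t| <= a^2], and this keeps the
    denominators [F - t G] away from 0. *)

Section Transfer.
Variables (R : realType) (p : R).
Hypotheses (p_gt0 : 0 < p) (p_lt1 : p < 1).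
Local Ltac plra := move: p_gt0 p_lt1 => ? ?; lra.
Local Ltac pnra := move: p_gt0 p_lt1 => ? ?; nra.
Local Notation lam := (lamPF p).
Local Notation rho := (lamr p).
Local Notation q := (1 - p).

(** * The eigenvalues of the transfer matrix and their ratio *)

Lemma lam_add_rho : lam + rho = q.
Proof. by rewrite /lamPF /lamr; field. Qed.

Lemma disc_gt0 : 0 < q * (3 * p + 1).
Proof. by apply: mulr_gt0; plra. Qed.

Lemma lam_sub_rho : lam - rho = Num.sqrt (q * (3 * p + 1)).
Proof. by rewrite /lamPF /lamr; field. Qed.

Lemma gap_gt0 : 0 < lam - rho.
Proof. by rewrite lam_sub_rho sqrtr_gt0 disc_gt0. Qed.

Lemma gap_sqr : (lam - rho) ^+ 2 = q * (3 * p + 1).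
Proof. by rewrite lam_sub_rho sqr_sqrtr // ltW // disc_gt0. Qed.

Lemma lam_mul_rho : lam * rho = - (p * q).
Proof.
have h : (lam - rho) ^+ 2 = (lam + rho) ^+ 2 - 4 * (lam * rho) by ring.
move: h; rewrite gap_sqr lam_add_rho => h.
have : 4 * (lam * rho) = 4 * (- (p * q)) by apply: (can_inj (addrK (q * (3 * p + 1)))); rewrite {1}h; ring.
plra.
Qed.

Lemma lam_sqr : lam ^+ 2 = q * (lam + p).
Proof.
have -> : rho = q - lam -> lam ^+ 2 = q * lam - lam * rho by move=> ->; ring.
  by rewrite lam_mul_rho; ring.
by rewrite -lam_add_rho; ring.
Qed.

Lemma rho_sqr : rho ^+ 2 = q * (rho + p).
Proof.
have -> : lam = q - rho -> rho ^+ 2 = q * rho - lam * rho by move=> ->; ring.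
  by rewrite lam_mul_rho; ring.
by rewrite -lam_add_rho; ring.
Qed.

Lemma lam_gt0 : 0 < lam.
Proof. move: gap_gt0 lam_add_rho; plra. Qed.

Lemma rho_lt0 : rho < 0.
Proof.
rewrite -(pmulr_rlt0 _ lam_gt0) lam_mul_rho oppr_lt0.
by apply: mulr_gt0; plra.
Qed.

Lemma q_le_lam : q <= lam.
Proof. move: rho_lt0 lam_add_rho; plra. Qed.

Lemma lam_lt1 : lam < 1.
Proof.
rewrite ltNge; apply/negP => h; move: lam_sqr lam_gt0 => e l0.
have : lam * 1 <= lam * lam by rewrite ler_pM2l.
by rewrite -expr2 e; pnra.
Qed.

Definition ratio : R := rho / lam.
Local Notation a := ratio.

Lemma ratio_lt0 : a < 0.
Proof. by rewrite /ratio pmulr_llt0 ?invr_gt0 ?lam_gt0 // rho_lt0. Qed.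

Lemma ratio1E : 1 + a = q / lam.
Proof. by rewrite -lam_add_rho /ratio mulrDl divff // gt_eqF // lam_gt0. Qed.

Lemma ratio_gtN1 : -1 < a.
Proof.
have : 0 < 1 + a by rewrite ratio1E divr_gt0 ?lam_gt0; plra.
plra.
Qed.

Lemma normr_ratio : `|a| = - a.
Proof. by rewrite ltr0_norm // ratio_lt0. Qed.

Lemma lamX_ratio c : lam ^+ c * a ^+ c = rho ^+ c.
Proof.
rewrite -exprMn; congr (_ ^+ c); rewrite /ratio mulrC divfK //.
by rewrite gt_eqF // lam_gt0.
Qed.

Lemma norm_ratioX_le1 c : `|a ^+ c| <= 1.
Proof.
by rewrite normrX exprn_ile1 // normr_ratio; move: ratio_lt0 ratio_gtN1; plra.
Qed.

Lemma norm_ratioX_anti c d : (c <= d)%N -> `|a ^+ d| <= `|a| ^+ c.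
Proof.
move=> cd; rewrite normrX -(subnKC cd) exprD ler_piMr ?exprn_ge0 //.
by rewrite exprn_ile1 // normr_ratio; move: ratio_lt0 ratio_gtN1; plra.
Qed.

Lemma norm_rhoX_le c : `|rho ^+ c| <= lam ^+ c.
Proof.
rewrite -lamX_ratio normrM ger0_norm ?exprn_ge0 ?(ltW lam_gt0) //.
by rewrite ler_piMr ?exprn_ge0 ?(ltW lam_gt0) // norm_ratioX_le1.
Qed.

Lemma ratio_sqr_lt1 : a ^+ 2 < 1.
Proof. by move: ratio_lt0 ratio_gtN1 => *; pnra. Qed.

Lemma one_sub_ratio_sqr : 1 - a ^+ 2 = q * (lam - rho) / lam ^+ 2.
Proof.
rewrite /ratio -lam_add_rho; field.
by rewrite gt_eqF // lam_gt0.
Qed.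

(** * Powers of the transfer matrix and weights of gaps *)

Lemma Qpow_rec k :
  (Qmat p ^+ k.+2) 0 0 = q * (Qmat p ^+ k.+1) 0 0 + p * q * (Qmat p ^+ k) 0 0.
Proof.
(* Cayley-Hamilton: the trace is [q] and the determinant is [- (p * q)]. *)
have ch : Qmat p ^+ 2 = q *: Qmat p + (p * q)%:M.
  apply/matrixP => i j; rewrite expr2 !mxE.
  have sq : Num.sqrt (p * q) * Num.sqrt (p * q) = p * q.
    by rewrite -expr2 sqr_sqrtr // mulr_ge0; plra.
  rewrite !big_ord_recl big_ord0 /= !mxE /= addr0.
  by case: i j => [[|[|i]]] //= hi [[|[|j]]] //= hj; rewrite ?sq; ring.
have -> : Qmat p ^+ k.+2 = q *: Qmat p ^+ k.+1 + (p * q) *: Qmat p ^+ k.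
  have -> : Qmat p ^+ k.+2 = Qmat p ^+ k * Qmat p ^+ 2.
    by rewrite expr2 mulrA -!exprSr.
  by rewrite ch mulrDr -scalerAr -exprSr -scalemx1 -scalerAr mulr1.
by rewrite !mxE.
Qed.

Lemma QpowE k : (Qmat p ^+ k) 0 0 = (lam ^+ k.+1 - rho ^+ k.+1) / (lam - rho).
Proof.
have nz : lam - rho != 0 by rewrite gt_eqF // gap_gt0.
suff: (Qmat p ^+ k) 0 0 = (lam ^+ k.+1 - rho ^+ k.+1) / (lam - rho) /\
  (Qmat p ^+ k.+1) 0 0 = (lam ^+ k.+2 - rho ^+ k.+2) / (lam - rho) by case.
elim: k => [|k [IH1 IH2]]; split => //.
- by rewrite expr0 mxE /= !expr1 divff.
- by rewrite expr1 mxE /= subr_sqr lam_add_rho mulrAC divff // mul1r.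
- rewrite Qpow_rec IH1 IH2 mulrA [in LHS]mulrA -mulrDl; congr (_ / _).
  have el : lam ^+ k.+3 = q * lam ^+ k.+2 + p * q * lam ^+ k.+1.
    have -> : lam ^+ k.+3 = lam ^+ k.+1 * lam ^+ 2 by rewrite -exprD addn2.
    by rewrite lam_sqr [lam ^+ k.+2]exprS; ring.
  have er : rho ^+ k.+3 = q * rho ^+ k.+2 + p * q * rho ^+ k.+1.
    have -> : rho ^+ k.+3 = rho ^+ k.+1 * rho ^+ 2 by rewrite -exprD addn2.
    by rewrite rho_sqr [rho ^+ k.+2]exprS; ring.
  by rewrite el er; ring.
Qed.

(** In this form [D] makes the gap that is infinite on both sides fit the general formula for an
    empty window, with both gap parameters equal to 0. *)
Lemma DconstE : Dconst p = (lam - rho) / lam ^+ 2.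
Proof.
have nz : lam != 0 by rewrite gt_eqF // lam_gt0.
have -> : Dconst p = (q * (lam + p) - (- (p * q))) / lam ^+ 3.
  by rewrite /Dconst; congr (_ / _); ring.
by rewrite -lam_sqr -lam_mul_rho; field.
Qed.

Definition leadgap (t : R) (c : nat) : R := lam ^+ c - t * rho ^+ c.
(** Weight of [g >= 1] zeros between two ones of the window: boundary sites and free part together
    give [q] times the entry (0,0) of [Q^(g-1)]. The value 0 at [g = 0] starts the recursion. *)
Definition midgap (g : nat) : R := q / (lam - rho) * leadgap 1 g.

Lemma leadgap_rec t c :
  leadgap t c.+2 = q * leadgap t c.+1 + p * q * leadgap t c.
Proof.
have el : lam ^+ c.+2 = lam ^+ c * lam ^+ 2 by rewrite -exprD addn2.
have er : rho ^+ c.+2 = rho ^+ c * rho ^+ 2 by rewrite -exprD addn2.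
by rewrite /leadgap el er lam_sqr rho_sqr !exprS; ring.
Qed.

Lemma leadgap_ge0 t c : `|t| <= 1 -> 0 <= leadgap t c.
Proof.
move=> t1; rewrite subr_ge0 (le_trans (ler_norm _)) // normrM.
by rewrite -[leRHS]mul1r ler_pM // norm_rhoX_le.
Qed.

Lemma midgap0 : midgap 0 = 0.
Proof. by rewrite /midgap /leadgap !expr0 mulr1 subrr mulr0. Qed.

Lemma midgap1 : midgap 1 = q.
Proof.
by rewrite /midgap /leadgap !expr1 mul1r divfK // gt_eqF // gap_gt0.
Qed.

Lemma midgap_rec g : midgap g.+2 = q * midgap g.+1 + p * q * midgap g.
Proof. by rewrite /midgap leadgap_rec; ring. Qed.

Lemma midgap_ge0 g : 0 <= midgap g.
Proof.
apply: mulr_ge0; last by rewrite leadgap_ge0 // normr1.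
by rewrite divr_ge0 ?(ltW gap_gt0) //; plra.
Qed.

Lemma midgapE k : midgap k.+1 = q * (Qmat p ^+ k) 0 0.
Proof. by rewrite QpowE /midgap /leadgap mul1r mulrAC mulrA. Qed.

Lemma midgap_le g : midgap g <= lam ^+ g.
Proof.
suff: midgap g <= lam ^+ g /\ midgap g.+1 <= lam ^+ g.+1 by case.
elim: g => [|g [IH1 IH2]]; split => //.
- by rewrite midgap0 expr0.
- by rewrite midgap1 expr1 q_le_lam.
- have := leadgap_rec 0 g; rewrite /leadgap !mul0r !subr0 midgap_rec => ->.
  by rewrite lerD // ler_wpM2l // ?mulr_ge0 //; plra.
Qed.

(** Since [q * midgap g.+1 <= midgap g.+2], the recursion bounds [midgap g.+3] by
    [(q + p) * midgap g.+2]. *)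
Lemma midgap_anti g : midgap g.+2 <= midgap g.+1.
Proof.
rewrite midgap_rec; case: g => [|g].
  by rewrite midgap0 midgap1; pnra.
suff: q * midgap g.+1 <= midgap g.+2 by have := midgap_ge0 g.+1; pnra.
rewrite midgap_rec lerDl; apply: mulr_ge0; last exact: midgap_ge0.
by apply: mulr_ge0; plra.
Qed.

(* What lies to the right of the window: two ones, a one followed by a zero, or
   a gap of j >= 1 zeros, recorded as [s = ratio ^+ j] ([s = 0] if the gap is
   infinite).  The gap to its left is recorded by [t] in the same way. *)
Inductive renv := R11 | R10 | RZ of R.

(* Scanning the window from the left: in a run of zeros of known length, after
   an isolated one (which needs a successor), or after at least two ones. *)
Inductive state := Gap of nat | One | Ones.

(** * The scan of the window *)

Definition coef (s : state) (b : bool) : R :=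
  match s, b with
  | Gap g, true => midgap g * p
  | _, true => p
  | One, false => 0
  | _, false => 1
  end.

Definition next (s : state) (b : bool) : state :=
  match s, b with
  | Gap _, true => One
  | _, true => Ones
  | Gap g, false => Gap g.+1
  | _, false => Gap 1
  end.

(** The zeros mark configurations outside [Omega']: an isolated one at [r + 1] for [R10], at [r] for
    [RZ]. The entry [1 - x] is [leadgap x 0]. *)
Definition inner_end (e : renv) (s : state) : R :=
  match e, s with
  | R11, Gap g => midgap g
  | R11, _ => 1
  | R10, Gap _ => 0
  | R10, _ => 1
  | RZ x, Gap g => leadgap x g
  | RZ x, One => 0
  | RZ x, Ones => 1 - x
  end.

Fixpoint inner (e : renv) (s : state) (x : seq bool) : R :=
  if x is b :: x' then coef s b * inner e (next s b) x' else inner_end e s.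

(** For [RZ s] the window is empty and joins both outer gaps into one, so their parameters multiply.
    This one gap is divided by two normalisations, each with a denominator [lam - rho], and keeps
    the [(1 - p)^-1] of its [Z]; hence the factor [(lam - rho) / q]. *)
Definition lead_end (e : renv) (t : R) (c : nat) : R :=
  match e with
  | R11 => leadgap t c
  | R10 => 0
  | RZ s => (lam - rho) / q * leadgap (t * s) c
  end.

Fixpoint lead (e : renv) (t : R) (c : nat) (x : seq bool) : R :=
  match x with
  | [::] => lead_end e t c
  | true :: x' => leadgap t c * p * inner e One x'
  | false :: x' => lead e t c.+1 x'
  end.

(** As [-1 < ratio < 0], the powers [ratio ^+ j] with [j >= 1], and their limit 0, all lie between
    the first and the second power. *)
Definition env_ok (e : renv) : Prop :=
  if e is RZ s then ratio <= s <= ratio ^+ 2 else True.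

Lemma env_norm s : env_ok (RZ s) -> `|s| <= - ratio.
Proof.
move=> /andP[h1 h2]; rewrite ler_norml opprK h1 (le_trans h2) //.
by move: ratio_lt0 ratio_gtN1 => *; nra.
Qed.

Lemma env_norm1 s : env_ok (RZ s) -> `|s| <= 1.
Proof. by move/env_norm => h; move: ratio_gtN1; move: h; lra. Qed.

Lemma coef_ge0 s b : 0 <= coef s b.
Proof.
have p0 := ltW p_gt0.
by case: s b => [g||] [] //=; apply: mulr_ge0 => //; apply: midgap_ge0.
Qed.

Lemma inner_ge0 e s x : env_ok e -> 0 <= inner e s x.
Proof.
move=> he; elim: x s => [|b x IH] s /=; last by rewrite mulr_ge0 ?coef_ge0.
case: e he s => [||y] he [g||] //=; rewrite ?ler01 ?midgap_ge0 //.
  exact/leadgap_ge0/env_norm1.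
by have := env_norm1 he; rewrite ler_norml; lra.
Qed.

(** * Affine dependence on the left gap *)

Lemma lead_lin e t c x :
  lead e t c x = lead e 0 c x - t * (lead e 0 c x - lead e 1 c x).
Proof.
elim: x c => [|[] x IH] c /=; last exact: IH.
  by case: e => [||s] /=; rewrite /leadgap; ring.
by rewrite /leadgap; ring.
Qed.

Lemma leadgap_dev s c : `|s| <= 1 ->
  `|leadgap 0 c - leadgap s c| <= leadgap 0 c.
Proof.
move=> s1; have -> : leadgap 0 c - leadgap s c = s * rho ^+ c.
  by rewrite /leadgap; ring.
rewrite /leadgap mul0r subr0 normrM -[leRHS]mul1r ler_pM //.
exact: norm_rhoX_le.
Qed.

(** Only a factor of the form [leadgap] depends on [t], and [|rho| <= lam] lets its constant part
    dominate the variable one. *)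
Lemma lead_dev e c x : env_ok e ->
  `|lead e 0 c x - lead e 1 c x| <= lead e 0 c x.
Proof.
move=> he; elim: x c => [|[] x IH] c /=; last exact: IH; last first.
  rewrite -!mulrBl !normrM (ger0_norm (inner_ge0 _ _ he)) (gtr0_norm p_gt0).
  rewrite ler_wpM2r ?inner_ge0 // ler_wpM2r ?(ltW p_gt0) //.
  by rewrite leadgap_dev // normr1.
case: e he => [||s] he /=.
- by rewrite leadgap_dev // normr1.
- by rewrite subrr normr0.
- rewrite mul0r mul1r -mulrBr normrM ger0_norm.
    rewrite ler_wpM2l ?leadgap_dev ?(env_norm1 he) //.
    by rewrite divr_ge0 ?(ltW gap_gt0) //; plra.
  by rewrite divr_ge0 ?(ltW gap_gt0) //; plra.
Qed.

(** * Upper bounds for single weights *)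

Definition state_wt (s : state) : R := if s is Gap g then lam ^+ g else 1.

(** [state_wt] is a potential for the scan: a zero costs at most [lam], a one costs [p], and the
    factor of a gap being closed is covered by the potential already stored, by [midgap_le]. *)
Lemma coef_next_le b s y : lam <= b -> p <= b ->
  coef s y * state_wt (next s y) <= state_wt s * b.
Proof.
move=> lb pb; have lg g : 0 <= lam ^+ g by rewrite exprn_ge0 // ltW // lam_gt0.
case: s y => [g||] [] /=; rewrite ?mulr1 ?mul1r ?mul0r ?expr1 //; last first.
- by move: p_gt0 => ?; lra.
- by rewrite exprSr ler_wpM2l.
- by apply: ler_pM => //; rewrite ?midgap_ge0 ?midgap_le ?(ltW p_gt0).
Qed.

(** The constant is taken from windows of one site rather than from the empty window: next to [R10]
    the last site must be a one, and the factor [p] that it brings has to stay in [K]. *)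
Lemma inner_le b K e s y x : lam <= b -> p <= b ->
  (forall s y, inner e s [:: y] <= K * state_wt s) ->
  inner e s (y :: x) <= K * state_wt s * b ^+ size x.
Proof.
move=> lb pb; have b0 : 0 <= b by apply: le_trans pb; rewrite ltW.
move=> base; have K0 : 0 <= K.
  by have := base Ones true; have := base One false; rewrite /= mulr1 mul0r.
elim: x s y => [|z x IH] s y; first by rewrite expr0 mulr1.
have -> : inner e s [:: y, z & x] = coef s y * inner e (next s y) (z :: x) by [].
apply: (le_trans (ler_wpM2l (coef_ge0 s y) (IH _ _))).
rewrite /= exprS !mulrA ler_wpM2r ?exprn_ge0 //.
by rewrite [coef s y * K]mulrC -!mulrA ler_wpM2l // coef_next_le.
Qed.

Lemma lead_le b K e c y x : lam <= b -> p <= b ->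
  (forall s y, inner e s [:: y] <= K * state_wt s) ->
  (forall c y, lead e 0 c [:: y] <= K * lam ^+ c) ->
  lead e 0 c (y :: x) <= K * lam ^+ c * b ^+ size x.
Proof.
move=> lb pb bi bl; have b0 : 0 <= b by apply: le_trans pb; rewrite ltW.
have K0 : 0 <= K by have := bi One false; rewrite /= mulr1 mul0r.
have lg g : 0 <= lam ^+ g by rewrite exprn_ge0 // ltW // lam_gt0.
elim: x c y => [|z x IH] c y; first by rewrite expr0 mulr1.
case: y; last first.
  apply: (le_trans (IH c.+1 z)); rewrite /=.
  rewrite [leLHS](_ : _ = K * lam ^+ c * b ^+ size x * lam); last by rewrite exprS; ring.
  rewrite [leRHS](_ : _ = K * lam ^+ c * b ^+ size x * b); last by rewrite exprS; ring.
  by rewrite ler_wpM2l // !mulr_ge0 // exprn_ge0.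
have -> : lead e 0 c [:: true, z & x] = lam ^+ c * p * inner e One (z :: x).
  by rewrite /= /leadgap mul0r subr0.
have := inner_le One z x lb pb bi; rewrite /= mulr1 => h.
apply: (le_trans (ler_wpM2l (mulr_ge0 (lg c) (ltW p_gt0)) h)).
rewrite [leLHS](_ : _ = K * lam ^+ c * b ^+ size x * p); last by ring.
rewrite [leRHS](_ : _ = K * lam ^+ c * b ^+ size x * b); last by rewrite exprS; ring.
by rewrite ler_wpM2l // !mulr_ge0 // exprn_ge0.
Qed.

(** * Sums over all fillings of the window, and their lower bound *)

Definition lsum (n : nat) (F : seq bool -> R) : R :=
  \sum_(xi : {ffun 'I_n -> bool}) F (codom xi).

Lemma lsum0 F : lsum 0 F = F [::].
Proof.
rewrite /lsum (eq_bigr (fun _ => F [::])) => [|xi _].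
  by rewrite big_const card_ffun card_ord expn0 /= addr0.
by congr F; apply: size0nil; rewrite size_codom card_ord.
Qed.

Lemma lsumS n F :
  lsum n.+1 F = lsum n (fun x => F (true :: x)) + lsum n (fun x => F (false :: x)).
Proof.
pose h (u : bool * {ffun 'I_n -> bool}) : {ffun 'I_n.+1 -> bool} :=
  [ffun i => oapp u.2 u.1 (unlift ord0 i)].
pose k (f : {ffun 'I_n.+1 -> bool}) : bool * {ffun 'I_n -> bool} :=
  (f ord0, [ffun j => f (lift ord0 j)]).
rewrite /lsum (reindex h); last first.
  exists k => [[b f] _|f _]; rewrite /h /k /=.
    rewrite ffunE unlift_none /=; congr pair.
    by apply/ffunP => j; rewrite !ffunE liftK.
  by apply/ffunP => i; rewrite ffunE; case: unliftP => [j ->|->] /=; rewrite ?ffunE.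
have codomh b f : codom (h (b, f)) = b :: codom f.
  rewrite !codomE enum_ordSl /= ffunE unlift_none /= -map_comp; congr cons.
  by apply: eq_map => j /=; rewrite ffunE liftK.
rewrite (eq_bigr (fun u : bool * {ffun 'I_n -> bool} => F (u.1 :: codom u.2))) => [|[b f] _]; last first.
  by rewrite codomh.
by rewrite -(pair_bigA _ (fun b (f : {ffun 'I_n -> bool}) => F (b :: codom f))) big_bool.
Qed.

Lemma lsumZ n c F : lsum n (fun x => c * F x) = c * lsum n F.
Proof. by rewrite /lsum mulr_sumr. Qed.

Lemma lsum_innerS n e s : lsum n.+1 (inner e s) =
  coef s true * lsum n (inner e (next s true)) +
  coef s false * lsum n (inner e (next s false)).
Proof. by rewrite lsumS /= !lsumZ. Qed.

Lemma lsum_leadS n e t c : lsum n.+1 (lead e t c) =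
  leadgap t c * p * lsum n (inner e One) + lsum n (lead e t c.+1).
Proof. by rewrite lsumS /= lsumZ. Qed.

(** The profile multiplied by [k] consists of the exact sums for the right side [R11], which do not
    depend on the length of a nonempty window ([lsum_R11]); this is why it is fixed by the
    recursion. [low_lead] uses the corresponding sum at [t = 0]. *)
Definition low_inner (k : R) (e : renv) (n : nat) : Prop :=
  [/\ p * k <= lsum n (inner e One), k <= lsum n (inner e Ones) &
   forall g, k * (midgap g.+2 + p * midgap g.+1) <= lsum n (inner e (Gap g.+1))].

Definition low_lead (k : R) (e : renv) (n : nat) : Prop :=
  forall c, k * (lam ^+ c * (lam + p)) <= lsum n (lead e 0 c).

(* The bounds are fixed points of the transfer recursion, so that it suffices to
   check them on windows of one site. *)
Lemma low_step k e n : 0 <= k -> low_inner k e n -> low_lead k e n ->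
  low_inner k e n.+1 /\ low_lead k e n.+1.
Proof.
move=> k0 [h1 h2 h3] hl; split; first split.
- by rewrite lsum_innerS /= mul0r addr0 ler_wpM2l // ltW.
- rewrite lsum_innerS /= mul1r.
  have := h3 0%N; rewrite midgap_rec midgap0 midgap1.
  by have := ler_wpM2l (ltW p_gt0) h2; move: k0; set A := lsum _ _; set B := lsum _ _; pnra.
- move=> g; rewrite lsum_innerS /= mul1r.
  have h := ler_wpM2l (mulr_ge0 (midgap_ge0 g.+1) (ltW p_gt0)) h1.
  apply: le_trans (lerD h (h3 g.+1)).
  by rewrite [midgap g.+3]midgap_rec le_eqVlt; apply/orP; left; apply/eqP; ring.
- move=> c; rewrite lsum_leadS.
  have lg : 0 <= leadgap 0 c * p by rewrite mulr_ge0 ?leadgap_ge0 ?normr0 ?ltW.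
  apply: le_trans (lerD (ler_wpM2l lg h1) (hl c.+1)).
  rewrite /leadgap mul0r subr0 exprS le_eqVlt; apply/orP; left; apply/eqP.
  have -> : k * (lam * lam ^+ c * (lam + p)) = k * lam ^+ c * (lam ^+ 2 + p * lam).
    by ring.
  by rewrite lam_sqr; ring.
Qed.

Lemma low_all k e n : 0 <= k -> low_inner k e 1 -> low_lead k e 1 ->
  low_lead k e n.+1.
Proof.
move=> k0 h1 h2.
suff: low_inner k e n.+1 /\ low_lead k e n.+1 by case.
by elim: n => [|n [IH1 IH2]] //; apply: low_step.
Qed.
Lemma lsum1 F : lsum 1 F = F [:: true] + F [:: false].
Proof. by rewrite lsumS !lsum0. Qed.

Lemma lam_nz : lam != 0.
Proof. by rewrite gt_eqF // lam_gt0. Qed.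

Lemma rho_le_env s : env_ok (RZ s) -> rho <= s * lam.
Proof. by move=> /andP[h _]; rewrite -ler_pdivrMr // lam_gt0. Qed.

Lemma lam_add_p : 1 <= lam + p <= 2.
Proof. by move: q_le_lam lam_lt1 => *; apply/andP; split; plra. Qed.

(** A multiple of the fixed profile lying below the one-site sums. For [R10] the site must be a one,
    of weight [p], and the 2 comes from [lam + p <= 2]; for [RZ s] it is the end value after at
    least two ones. *)
Definition kap (e : renv) : R :=
  match e with R11 => 1 | R10 => p / 2 | RZ s => 1 - s end.

Lemma env_lt1 s : env_ok (RZ s) -> s < 1.
Proof. by move=> /andP[_ h]; apply: le_lt_trans h ratio_sqr_lt1. Qed.

Lemma kap_gt0 e : env_ok e -> 0 < kap e.
Proof.
by case: e => [||s] //= he; [plra | rewrite subr_gt0; apply: env_lt1].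
Qed.

Lemma low_inner1 e : env_ok e -> low_inner (kap e) e 1.
Proof.
move=> he; split; first (rewrite lsum1 /= mul0r addr0); first 1 last.
- rewrite lsum1 /= mul1r; case: e he => [||s] he /=.
  + by rewrite midgap1; plra.
  + by plra.
  + have := rho_le_env he; rewrite /leadgap !expr1.
    have : s * (lam + rho) = s * q by rewrite lam_add_rho.
    by move: lam_add_rho; lra.
- move=> g; rewrite lsum1 /= mul1r; case: e he => [||s] he /=.
  + by rewrite mul1r mulr1 [p * _]mulrC addrC.
  + have := midgap_anti g; have := midgap_ge0 g.+1.
    set A := midgap g.+1; set B := midgap g.+2 => hA hB.
    have hp : p * B <= p * A by rewrite ler_wpM2l // ltW.
    have : p * (p * A) <= p * A by apply: ler_piMl; [apply: mulr_ge0 => //; exact: ltW | exact: ltW].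
    by rewrite mulr1 addr0 mulrDr; move: hp; plra.
  + rewrite mulr0 add0r.
    have -> : midgap g.+2 + p * midgap g.+1 = (Qmat p ^+ g.+2) 0 0.
      by rewrite !midgapE Qpow_rec mulrA.
    rewrite QpowE mulrA ler_pdivrMr ?gap_gt0 // -subr_ge0.
    (* Once [lam - rho] is cleared the difference factors, and [s >= ratio] makes the first factor
       nonnegative. *)
    rewrite [leRHS](_ : _ = (s * lam - rho) * leadgap 1 g.+2); last first.
      by rewrite /leadgap ![_ ^+ g.+3]exprS; ring.
    apply: mulr_ge0; first by rewrite subr_ge0 rho_le_env.
    by rewrite leadgap_ge0 // normr1.
- case: e he => [||s] he //=; first by rewrite mulr1 ler_piMr; plra.
Qed.

Lemma low_lead1 e : env_ok e -> low_lead (kap e) e 1.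
Proof.
move=> he c; rewrite lsum1 /=.
have lg g : 0 <= lam ^+ g by rewrite exprn_ge0 // ltW // lam_gt0.
case: e he => [||s] he /=; rewrite /leadgap ?mul0r ?subr0.
- by rewrite exprS; move: (lg c) => *; nra.
- have h0 : 0 <= lam ^+ c * p by rewrite mulr_ge0 // ltW.
  have : lam ^+ c * p * (lam + p) <= lam ^+ c * p * 2.
    by rewrite ler_wpM2l //; case/andP: lam_add_p.
  by rewrite mulr1 addr0; lra.
- rewrite mulr0 add0r.
  have -> : lam + p = lam ^+ 2 / q.
    by rewrite lam_sqr mulrAC divff ?mul1r // gt_eqF //; plra.
  rewrite [leLHS](_ : _ = lam ^+ c.+1 / q * ((1 - s) * lam)); last first.
    by rewrite [lam ^+ c.+1]exprS; ring.
  rewrite [leRHS](_ : _ = lam ^+ c.+1 / q * (lam - rho)); last by ring.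
  rewrite ler_wpM2l ?divr_ge0 //; first by plra.
  by have := rho_le_env he; lra.
Qed.

(** * Probabilities at [t = 0], uniformly in the right side *)

Definition top (b : R) (e : renv) : R :=
  match e with
  | R11 => b
  | R10 => p
  | RZ s => (1 - s) * (lam ^+ 2 / q ^+ 2) * b
  end.

(** Equality holds at the largest admissible value [s = ratio ^+ 2]; this is the origin of the
    factor [lam ^+ 2 / q ^+ 2] in [top]. *)
Lemma env_top s : env_ok (RZ s) -> (lam - rho) / q <= (1 - s) * (lam ^+ 2 / q ^+ 2).
Proof.
move=> /andP[_ h].
have qn : q != 0 by rewrite gt_eqF //; plra.
have -> : (lam - rho) / q = (1 - ratio ^+ 2) * (lam ^+ 2 / q ^+ 2).
  by rewrite one_sub_ratio_sqr; field; rewrite ?lam_nz ?qn.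
rewrite ler_wpM2r ?lerD2l ?lerN2 // divr_ge0 ?sqr_ge0 //.
Qed.

Lemma leadgap_top s g : env_ok (RZ s) -> leadgap s g <= (lam - rho) / q * lam ^+ g.
Proof.
move=> he.
have lg : 0 <= lam ^+ g by rewrite exprn_ge0 // ltW // lam_gt0.
have h1 : leadgap s g <= (1 - ratio) * lam ^+ g.
  rewrite /leadgap -lamX_ratio.
  have -> : lam ^+ g - s * (lam ^+ g * ratio ^+ g) = (1 - s * ratio ^+ g) * lam ^+ g.
    by ring.
  rewrite ler_wpM2r // lerD2l lerNl opprK.
  have : `|s * ratio ^+ g| <= - ratio.
    rewrite normrM -[leRHS]mulr1 ler_pM // ?env_norm //.
    exact: norm_ratioX_le1.
  by rewrite ler_norml opprK => /andP[].
apply: (le_trans h1); rewrite ler_wpM2r //.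
have -> : 1 - ratio = (lam - rho) / lam by rewrite /ratio; field; exact: lam_nz.
rewrite ler_wpM2l ?(ltW gap_gt0) // lef_pV2 ?posrE ?lam_gt0 ?q_le_lam //.
by plra.
Qed.

Lemma top_inner b e s y : env_ok e -> lam <= b -> p <= b ->
  inner e s [:: y] <= top b e * state_wt s.
Proof.
move=> he lb pb /=.
have sw z : 0 <= state_wt z by case: z => //= g; rewrite exprn_ge0 // ltW // lam_gt0.
have gen K : 0 <= K -> (forall z, inner_end e z <= K * state_wt z) ->
    coef s y * inner_end e (next s y) <= K * b * state_wt s.
  move=> K0 h; apply: (le_trans (ler_wpM2l (coef_ge0 s y) (h _))).
  by rewrite mulrCA -mulrA ler_wpM2l // [b * _]mulrC coef_next_le.
case: e he gen => [||x] he gen.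
- rewrite -[top b R11]mul1r; apply: gen => // -[g||] /=; rewrite ?mul1r //.
  exact: midgap_le.
(* For [R10] the general argument would only give [b]; here the site must be a one, which gives
   [p]. *)
- have p0 := ltW p_gt0.
  clear gen; case: y; last first.
    case: s => [g||] /=; rewrite mulr0 ?mulr1 //.
    by apply: mulr_ge0 => //; exact: (sw (Gap g)).
  case: s => [g||] /=; rewrite ?mulr1 //.
  by rewrite [midgap g * p]mulrC ler_wpM2l // midgap_le.
- have x1 : 0 <= 1 - x by rewrite subr_ge0 ltW // env_lt1.
  have l0 : 0 <= lam ^+ 2 / q ^+ 2 by rewrite divr_ge0 // sqr_ge0.
  apply: gen; first exact: mulr_ge0.
  case=> [g||] /=; last rewrite mulr1.
  + apply: (le_trans (leadgap_top g he)); rewrite ler_wpM2r ?env_top //.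
    exact: (sw (Gap g)).
  + by rewrite mulr1 mulr_ge0.
  rewrite ler_peMr // -expr_div_n exprn_ege1 // ler_pdivlMr ?mul1r ?q_le_lam //.
  by plra.
Qed.

Lemma top_lead b e c y : env_ok e -> lam <= b -> p <= b ->
  lead e 0 c [:: y] <= top b e * lam ^+ c.
Proof.
move=> he lb pb.
have lg g : 0 <= lam ^+ g by rewrite exprn_ge0 // ltW // lam_gt0.
have b0 : 0 <= b by apply: le_trans pb; rewrite ltW.
case: y => /=.
  rewrite /leadgap mul0r subr0 -mulrA [leRHS]mulrC ler_wpM2l //.
  by have := top_inner One true he lb pb; rewrite /= mulr1; apply: le_trans;
    case: e he => [||x] he //=; rewrite mulr0 mulr_ge0 ?subr_ge0 ?ltW // env_lt1.
case: e he => [||x] he /=; rewrite /leadgap ?mul0r ?subr0.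
- by rewrite exprS ler_wpM2r.
- by rewrite mulr_ge0 // ltW.
- rewrite exprS mulrA ler_wpM2r //; apply: ler_pM => //.
  + by rewrite divr_ge0 ?(ltW gap_gt0) //; plra.
  + exact/ltW/lam_gt0.
  + exact: env_top.
Qed.

Lemma lead_ge0 e c x : env_ok e -> 0 <= lead e 0 c x.
Proof. by move=> he; apply: le_trans (lead_dev c x he); exact: normr_ge0. Qed.

Lemma lsum_lead_ge e n : env_ok e -> kap e <= lsum n.+1 (lead e 0 0).
Proof.
move=> he; have k0 := ltW (kap_gt0 he).
have := low_all n k0 (low_inner1 he) (low_lead1 he) 0%N.
apply: le_trans; rewrite expr0 mul1r ler_peMr //; by case/andP: lam_add_p.
Qed.

(** Both bounds degenerate through the same factor, [p] for [R10] and [1 - s] for [RZ s], so their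
    quotient is controlled uniformly. *)
Lemma top_le b e : env_ok e -> lam <= b -> p <= b ->
  top b e <= 2 / q * kap e * b.
Proof.
move=> he lb pb; have qp : 0 < q by plra.
have q1 : 1 <= q^-1 by rewrite invf_ge1 //; plra.
have b0 : 0 < b by apply: lt_le_trans pb.
case: e he => [||s] he /=.
- by rewrite mulr1 ler_peMl ?(ltW b0) //; lra.
- rewrite [leRHS](_ : _ = p * (b / q)); last by field; rewrite gt_eqF.
  rewrite ler_peMr ?(ltW p_gt0) // ler_pdivlMr // mul1r.
  exact: le_trans q_le_lam lb.
- rewrite ler_wpM2r ?(ltW b0) // mulrC ler_wpM2r ?subr_ge0 ?(ltW (env_lt1 he)) //.
  rewrite lam_sqr [leLHS](_ : _ = (lam + p) / q); last by field; rewrite gt_eqF.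
  by rewrite ler_wpM2r ?invr_ge0 ?(ltW qp) //; case/andP: lam_add_p.
Qed.

Lemma lead_prob_le b e n x : env_ok e -> lam <= b -> p <= b -> size x = n.+1 ->
  lead e 0 0 x <= 2 / q * b ^+ n.+1 * lsum n.+1 (lead e 0 0).
Proof.
move=> he lb pb; case: x => // y x [sx].
have b0 : 0 <= b by apply: le_trans pb; rewrite ltW.
have := lead_le 0 y x lb pb (fun s z => top_inner s z he lb pb)
  (fun c z => top_lead c z he lb pb).
move/le_trans; apply; rewrite expr0 mulr1 sx.
apply: (le_trans (ler_wpM2r (exprn_ge0 n b0) (top_le he lb pb))).
rewrite [leLHS](_ : _ = 2 / q * b ^+ n.+1 * kap e); last by rewrite exprS; ring.
rewrite ler_wpM2l ?lsum_lead_ge // mulr_ge0 ?exprn_ge0 // divr_ge0 //; by plra.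
Qed.

(** * The effect of changing the parameter of the left gap *)

Lemma one_sub_ratio_sqr_ge : q <= (1 - ratio ^+ 2) ^+ 2.
Proof.
have qp : 0 < q by plra.
rewrite one_sub_ratio_sqr expr_div_n exprMn gap_sqr lam_sqr.
rewrite exprMn -mulf_div divff ?mul1r; last by rewrite sqrf_eq0 gt_eqF.
have l0 : 0 < lam + p by case/andP: lam_add_p; lra.
rewrite ler_pdivlMr ?exprn_gt0 // ler_wpM2l ?(ltW qp) //.
have l1 : lam + p <= 1 + p by move: lam_lt1; lra.
apply: (@le_trans _ _ ((1 + p) ^+ 2)); first by rewrite lerXn2r ?nnegrE //; plra.
by pnra.
Qed.

(** Over the common denominator the numerator collapses to [(t - t') * (f * G - g * F)], while each
    of the two denominators is at least [F * d]. *)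
Lemma frac_diff_le (f g F G t t' d m : R) : 0 < F -> `|G| <= F -> `|g| <= f ->
  `|t| <= m -> `|t'| <= m -> 0 < d -> `|t| <= 1 - d -> `|t'| <= 1 - d ->
  `|(f - t * g) / (F - t * G) - (f - t' * g) / (F - t' * G)|
    <= 4 * m / d ^+ 2 * (f / F).
Proof.
move=> F0 hG hg tm tm' d0 td td'.
have f0 : 0 <= f by apply: le_trans hg.
have den (s : R) : `|s| <= 1 - d -> F * d <= F - s * G.
  move=> sd; have : `|s * G| <= (1 - d) * F by rewrite normrM ler_pM.
  by rewrite ler_norml => /andP[]; lra.
have Fd : 0 < F * d by rewrite mulr_gt0.
have D0 := lt_le_trans Fd (den _ td); have D0' := lt_le_trans Fd (den _ td').
rewrite [X in `|X|](_ : _ =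
  (t - t') * (f * G - g * F) / ((F - t * G) * (F - t' * G))); last first.
  by field; rewrite !gt_eqF.
rewrite normrM normfV [X in _ / X]gtr0_norm ?mulr_gt0 // ler_pdivrMr ?mulr_gt0 //.
have num : `|(t - t') * (f * G - g * F)| <= 2 * m * (2 * f * F).
  rewrite normrM ler_pM //.
    by apply: (le_trans (ler_normB _ _)); move: tm tm'; lra.
  apply: (le_trans (ler_normB _ _)); rewrite !normrM (ger0_norm f0) (gtr0_norm F0).
  have : f * `|G| <= f * F by rewrite ler_wpM2l.
  have : `|g| * F <= f * F by rewrite ler_wpM2r // ltW.
  lra.
apply: (le_trans num).
have m0 : 0 <= m by apply: le_trans tm.
have h := ler_pM (ltW Fd) (ltW Fd) (den _ td) (den _ td').
rewrite [leLHS](_ : _ = 4 * m / d ^+ 2 * (f / F) * (F * d * (F * d))); last first.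
  by field; rewrite !gt_eqF.
by rewrite ler_wpM2l // !mulr_ge0 ?invr_ge0 ?sqr_ge0 // ltW.
Qed.

Lemma lsum_lead_lin n e t : lsum n (lead e t 0) =
  lsum n (lead e 0 0) - t * (lsum n (lead e 0 0) - lsum n (lead e 1 0)).
Proof.
rewrite /lsum -sumrB mulr_sumr -sumrB; apply: eq_bigr => xi _.
exact: lead_lin.
Qed.

Lemma lead_ratio_diff b e n k x t t' : env_ok e -> lam <= b -> p <= b ->
  size x = n.+1 -> (1 < k)%N -> `|t| <= `|ratio| ^+ k -> `|t'| <= `|ratio| ^+ k ->
  `|lead e t 0 x / lsum n.+1 (lead e t 0) -
    lead e t' 0 x / lsum n.+1 (lead e t' 0)|
    <= 12 / q ^+ 2 * b ^+ n.+1 * `|ratio| ^+ k.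
Proof.
move=> he lb pb sx k1 ht ht'; have qp : 0 < q by plra.
have b0 : 0 <= b by apply: le_trans pb; rewrite ltW.
rewrite !(lead_lin e t) !(lead_lin e t') !(lsum_lead_lin _ e t) !(lsum_lead_lin _ e t').
have F0 := lt_le_trans (kap_gt0 he) (lsum_lead_ge n he).
(* [1 < k] allows [d = 1 - ratio ^+ 2] in [frac_diff_le]. *)
have d0 : 0 < 1 - ratio ^+ 2 by rewrite subr_gt0 ratio_sqr_lt1.
have k2 : `|ratio| ^+ k <= ratio ^+ 2.
  by have := norm_ratioX_anti k1; rewrite normrX real_normK // num_real.
have GF : `|lsum n.+1 (lead e 0 0) - lsum n.+1 (lead e 1 0)| <= lsum n.+1 (lead e 0 0).
  rewrite /lsum -sumrB (le_trans (ler_norm_sum _ _ _)) // ler_sum // => xi _.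
  exact: lead_dev.
have := frac_diff_le F0 GF (lead_dev 0 x he) ht ht' d0.
rewrite opprB addrC subrK => /(_ (le_trans ht k2) (le_trans ht' k2)).
move/le_trans; apply.
have pr : lead e 0 0 x / lsum n.+1 (lead e 0 0) <= 2 / q * b ^+ n.+1.
  by rewrite ler_pdivrMr // lead_prob_le.
set m := `|ratio| ^+ k; have m0 : 0 <= m by rewrite exprn_ge0.
have bn : 0 <= b ^+ n.+1 by rewrite exprn_ge0.
have dq : 4 * m / (1 - ratio ^+ 2) ^+ 2 <= 4 * m / q.
  rewrite ler_wpM2l ?mulr_ge0 // lef_pV2 ?posrE ?exprn_gt0 //.
  exact: one_sub_ratio_sqr_ge.
(* [4 / q] comes from the change of [t] and [2 / q] from the probability at [t = 0]; the product,
   with constant 8, is then enlarged to 12, half of the final 24. *)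
apply: (@le_trans _ _ (4 * m / q * (2 / q * b ^+ n.+1))).
  apply: ler_pM => //; first by rewrite divr_ge0 ?sqr_ge0 ?mulr_ge0.
  by rewrite divr_ge0 ?lead_ge0 // ltW.
rewrite [leLHS](_ : _ = 8 * (q ^-2 * b ^+ n.+1 * m)); last by field; rewrite gt_eqF.
rewrite [leRHS](_ : _ = 12 * (q ^-2 * b ^+ n.+1 * m)); last by field; rewrite gt_eqF.
rewrite ler_wpM2r ?ler_nat // !mulr_ge0 // invr_ge0 sqr_ge0 //.
Qed.

(** * Exact sums for an occupied right side, and the lower bound *)

Lemma lsum_R11 n : [/\ lsum n.+1 (inner R11 One) = p,
  lsum n.+1 (inner R11 Ones) = 1 &
  forall g, lsum n.+1 (inner R11 (Gap g.+1)) = midgap g.+2 + p * midgap g.+1].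
Proof.
elim: n => [|n [h1 h2 h3]].
  by split=> [||g]; rewrite lsum1 /= ?midgap1; ring.
split=> [||g]; rewrite lsum_innerS /=.
- by rewrite h2; ring.
- by rewrite h2 h3 midgap_rec midgap0 midgap1; ring.
- by rewrite h1 h3 [midgap g.+3]midgap_rec; ring.
Qed.

Lemma lsum_lead_R11 n t c : lsum n.+1 (lead R11 t c) =
  leadgap t c.+1 + p * leadgap t c.
Proof.
elim: n c => [|n IH] c; first by rewrite lsum1 /=; ring.
have [h1 _ _] := lsum_R11 n.
by rewrite lsum_leadS h1 IH leadgap_rec; ring.
Qed.

Lemma inner_R11_ones n : inner R11 Ones (nseq n true) = p ^+ n.
Proof. by elim: n => [|n IH] /=; rewrite ?expr0 // IH exprS. Qed.

Lemma lead_R11_ones n t : lead R11 t 0 (nseq n.+1 true) = (1 - t) * p ^+ n.+1.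
Proof.
have -> : lead R11 t 0 (nseq n.+1 true) = (1 - t) * p * inner R11 One (nseq n true).
  by rewrite /= /leadgap !expr0 mulr1.
case: n => [|n]; first by rewrite /= mulr1.
by rewrite /= inner_R11_ones !exprS; ring.
Qed.

(** The probability of the full window is [(1 - t) * p ^+ n.+1 / (lam + p - t * (rho + p))], so the
    difference from its value at 0 is a multiple of [t * (rho - lam)]. The two denominators are at
    most 3 and 2, whence the 6, and [lam - rho] is at least [Num.sqrt q]. *)
Lemma lead_R11_diff n k :
  Num.sqrt q / 6 * p ^+ n.+1 * `|ratio| ^+ k <=
  `|lead R11 (ratio ^+ k) 0 (nseq n.+1 true) / lsum n.+1 (lead R11 (ratio ^+ k) 0) -
    lead R11 0 0 (nseq n.+1 true) / lsum n.+1 (lead R11 0 0)|.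
Proof.
set t := ratio ^+ k.
have t1 : `|t| <= 1 by exact: norm_ratioX_le1.
rewrite !lead_R11_ones !lsum_lead_R11 /leadgap !expr0 !expr1 !mul0r !subr0 !mulr1 mul1r.
have l0 : 0 < lam + p by case/andP: lam_add_p; lra.
have rp : rho + p = 1 - lam by move: lam_add_rho; lra.
have tr : `|t * (rho + p)| <= 1.
  rewrite normrM -[leRHS]mulr1 ler_pM // rp ger0_norm; move: lam_lt1 lam_gt0; lra.
have D1 : 0 < lam - t * rho + p * (1 - t).
  rewrite (_ : _ + _ = lam + p - t * (rho + p)); last by ring.
  have : `|t * (rho + p)| < lam + p.
    case: (ltrgtP lam q) => h; first by move: q_le_lam; lra.
      by apply: le_lt_trans tr _; lra.
    by move: rho_lt0 lam_add_rho; lra.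
  by rewrite ltr_norml => /andP[]; lra.
rewrite [X in _ <= `|X|](_ : _ = p ^+ n.+1 * (t * (rho - lam)) /
   ((lam - t * rho + p * (1 - t)) * (lam + p))); last first.
  by field; rewrite !gt_eqF.
rewrite [leRHS]normrM normfV [X in _ <= _ / X]gtr0_norm ?mulr_gt0 // ler_pdivlMr ?mulr_gt0 //.
rewrite [leRHS]normrM [`|t * _|]normrM (ger0_norm (exprn_ge0 _ (ltW p_gt0))) -normrX -/t distrC (gtr0_norm gap_gt0).
have sq : Num.sqrt q <= lam - rho.
  rewrite lam_sub_rho ler_sqrt; last exact/ltW/disc_gt0.
  by pnra.
have D6 : (lam - t * rho + p * (1 - t)) * (lam + p) <= 6.
  rewrite (_ : lam - _ + _ = lam + p - t * (rho + p)); last by ring.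
  rewrite (_ : 6 = 3 * 2); last by ring.
  move: tr lam_add_p; rewrite ler_norml => /andP[h1 h2] /andP[h3 h4].
  by apply: ler_pM; lra.
set D := _ * (lam + p) in D6 *; set P := p ^+ n.+1; set T := `|t|.
have P0 : 0 <= P by rewrite exprn_ge0 // ltW.
have T0 : 0 <= T by exact: normr_ge0.
have s0 : 0 <= Num.sqrt q by exact: sqrtr_ge0.
apply: (@le_trans _ _ (Num.sqrt q / 6 * P * T * 6)).
  by rewrite ler_wpM2l // !mulr_ge0 ?invr_ge0 ?ler0n.
rewrite (_ : _ * 6 = P * (T * Num.sqrt q)); last by field.
by rewrite ler_wpM2l // ler_wpM2l.
Qed.

End Transfer.

(** * Admissible configurations, ends of components, windows *)

Lemma Omega'P (w : config) :
  Omega' w <-> (forall x, w x -> w (x - 1) || w (x + 1)).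
Proof.
split=> [[w0 ->] x /andP[wx /orP[]] wy|h].
- by rewrite /Tmap wy subrK wx orbT.
- by apply/orP; right; rewrite /Tmap wy addrK wx.
(* Such a configuration is fixed by [Tmap], hence its own preimage. *)
- exists w; apply: funext => x; rewrite /Tmap.
  by have := h x; case: (w x) => //= ->.
Qed.

Lemma lend_some (w : config) (x a : int) : a <= x -> ~~ free w (a - 1) ->
  (forall y, a <= y <= x -> free w y) -> lend w x = Some a.
Proof.
move=> ax na fa; rewrite /lend; case: pselect => [H|]; last by case; exists a.
case: cid => b /= [bx [nb fb]]; congr Some; case: (ltrgtP a b) => // ab.
- by move: nb; rewrite fa //; lia.
- by move: na; rewrite fb //; lia.
Qed.

Lemma lend_none (w : config) (x : int) :
  (forall y, y <= x -> free w y) -> lend w x = None.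
Proof.
move=> h; rewrite /lend; case: pselect => [H|//]; exfalso; case: H => a [ax [na _]].
by move: na; rewrite h //; lia.
Qed.

Lemma rend_some (w : config) (x b : int) : x <= b -> ~~ free w (b + 1) ->
  (forall y, x <= y <= b -> free w y) -> rend w x = Some b.
Proof.
move=> ax na fa; rewrite /rend; case: pselect => [H|]; last by case; exists b.
case: cid => c /= [bx [nb fb]]; congr Some; case: (ltrgtP b c) => // ab.
- by move: na; rewrite fb //; lia.
- by move: nb; rewrite fa //; lia.
Qed.

Lemma rend_none (w : config) (x : int) :
  (forall y, x <= y -> free w y) -> rend w x = None.
Proof.
move=> h; rewrite /rend; case: pselect => [H|//]; exfalso; case: H => a [ax [na _]].
by move: na; rewrite h //; lia.
Qed.

Lemma window_nil (b : int) : window (b + 1) b = [::].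
Proof. by rewrite /window (_ : absz _ = 0%N) //; lia. Qed.

Lemma window_cons (a b : int) : a <= b -> window a b = a :: window (a + 1) b.
Proof.
move=> ab; rewrite /window (_ : absz (b - a + 1)%R = (absz (b - (a + 1) + 1)%R).+1); last by lia.
rewrite /= addr0 -[1%N]addn0 iotaDl -map_comp; congr cons.
by apply: eq_map => i /=; rewrite PoszD addrA.
Qed.

Lemma window_rcons (a b : int) : a <= b + 1 ->
  window a (b + 1) = rcons (window a b) (b + 1).
Proof.
move=> ab; rewrite /window (_ : absz (b + 1 - a + 1)%R = (absz (b - a + 1)%R).+1); last by lia.
rewrite -addn1 iotaD map_cat /= cats1 add0n; congr rcons.
by lia.
Qed.

Lemma mem_window (a b x : int) : a <= b + 1 -> (x \in window a b) = (a <= x <= b).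
Proof.
move=> ab; apply/mapP/idP => [[i]|h].
  by rewrite mem_iota => ? ->; lia.
by exists (absz (x - a)%R); rewrite ?mem_iota; lia.
Qed.

Lemma expr_count (S : realType) (T : Type) (x : S) (P : pred T) s :
  x ^+ count P s = \prod_(i <- s) x ^+ P i.
Proof. by elim: s => [|i s IH]; rewrite ?big_nil // big_cons /= exprD IH. Qed.

Lemma freeN (v : config) x : v x -> free v x = false.
Proof. by rewrite /free => ->; rewrite andbF. Qed.

Lemma freeNl (v : config) x : v (x - 1) -> free v x = false.
Proof. by rewrite /free => ->. Qed.

Lemma freeNr (v : config) x : v (x + 1) -> free v x = false.
Proof. by rewrite /free => ->; rewrite !andbF. Qed.

Lemma freeT (v : config) x : ~~ v (x - 1) -> ~~ v x -> ~~ v (x + 1) -> free v x.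
Proof. by rewrite /free => -> -> ->. Qed.

(** * The weight as a product over sites *)

Section Weight.
Variables (R : realType) (p : R).
Hypotheses (p_gt0 : 0 < p) (p_lt1 : p < 1).
Local Notation lam := (lamPF p).
Local Notation rho := (lamr p).
Local Notation q := (1 - p).
Local Notation a := (ratio p).
Variables (l r : int).
Hypothesis lr : l <= r.
Implicit Types (v : config) (x y m d f : int).

(** A component is charged at its leftmost site in the window, so the product can be cut at any site
    and read off from the right. *)
Definition psi (v : config) (x : int) : R :=
  (if (l - 1 <= x) && (x <= r + 1) then p ^+ v x * q ^+ bdry v x else 1) *
  (if free v x && ((x == l - 2) || ~~ free v (x - 1))
   then ZU p l r (lend v x) (rend v x) else 1).

Definition suf (v : config) (m : int) : R :=
  \prod_(x <- window m (r + 2)) psi v x.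

Lemma suf_end v : suf v (r + 3) = 1.
Proof. 
have -> : r + 3 = r + 2 + 1 by lia.
by rewrite /suf window_nil big_nil.
 Qed.

Lemma suf_cons v m : m <= r + 2 -> suf v m = psi v m * suf v (m + 1).
Proof. by move=> h; rewrite /suf window_cons // big_cons. Qed.

Lemma weightE v : weight p l r v = suf v (l - 2).
Proof.
have lr' := lr.
rewrite /suf /psi big_split /= /weight; congr (_ * _); last by rewrite big_mkcond.
rewrite [window (l - 2) _]window_cons; last by lia.
have -> : l - 2 + 1 = l - 1 by lia.
have -> : r + 2 = r + 1 + 1 by lia.
rewrite [window (l - 1) (r + 1 + 1)]window_rcons; last by lia.
rewrite big_cons big_rcons /= !ifF; [|lia|lia].
rewrite mul1r mulr1 !expr_count -big_split /=.
apply: eq_big_seq => x; rewrite mem_window; last by lia.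
by move=> h; rewrite ifT //; lia.
Qed.

Lemma suf_skip v m m' : m <= m' -> m' <= r + 3 ->
  (forall x, m <= x < m' -> psi v x = 1) -> suf v m = suf v m'.
Proof.
move=> h1 h2 h; have [n e] : exists n : nat, m' = m + n%:Z.
  by exists (absz (m' - m)%R); lia.
elim: n m e h1 h => [|n IH] m e h1 h; first by rewrite e addr0.
rewrite suf_cons; last by lia.
rewrite h ?mul1r; last by lia.
by apply: IH => [||x hx]; [lia|lia|apply: h; lia].
Qed.

Lemma psi_nfree v x : free v x = false ->
  psi v x = if (l - 1 <= x) && (x <= r + 1) then p ^+ v x * q ^+ bdry v x else 1.
Proof. by move=> f; rewrite /psi f mulr1. Qed.

Lemma psi_out v x : free v x = false -> (x < l - 1) || (r + 1 < x) -> psi v x = 1.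
Proof. by move=> f h; rewrite psi_nfree // ifF //; lia. Qed.

Lemma psi_one v x : v x -> l - 1 <= x <= r + 1 -> psi v x = p.
Proof.
by move=> vx h; rewrite psi_nfree ?freeN // h /bdry vx /= expr1 expr0 mulr1.
Qed.

Lemma psi_bdry v x : ~~ v x -> v (x - 1) || v (x + 1) -> l - 1 <= x <= r + 1 ->
  psi v x = q.
Proof.
move=> nx b h; rewrite psi_nfree; last first.
  by case/orP: b; [exact: freeNl | exact: freeNr].
by rewrite h /bdry (negbTE nx) b /= expr0 expr1 mul1r.
Qed.

Lemma psi_free v x : free v x ->
  psi v x = if (x == l - 2) || ~~ free v (x - 1)
            then ZU p l r (lend v x) (rend v x) else 1.
Proof.
move=> f; rewrite /psi f /=.
have [-> ->] : v x = false /\ bdry v x = false.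
  move: f; rewrite /free /bdry => /andP[/andP[/negbTE-> /negbTE->] /negbTE->].
  by rewrite andbF.
by rewrite !expr0 mulr1 if_same mul1r.
Qed.

(** * The contribution of each kind of gap *)

Lemma close_in v x0 f : l - 2 <= x0 -> x0 + 2 <= f -> f <= r + 2 ->
  (forall y, x0 - 1 <= y < f -> ~~ v y) -> v f ->
  suf v (x0 + 1) = q * suf v f.
Proof.
move=> h1 h2 h3 z vf.
rewrite (@suf_skip v (x0 + 1) (f - 1)); [|lia|lia|] => [|x hx]; last first.
  rewrite psi_free ?ifF //; last by apply: freeT; apply: z; lia.
  rewrite [free _ _]freeT ?orbF; [|apply: z; lia..].
  by lia.
rewrite suf_cons ?subrK; last by lia.
rewrite psi_bdry //; [apply: z; lia| by rewrite subrK vf orbT | lia].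
Qed.

(** A right boundary site of this run, if there is one, lies beyond [r + 1] and is not charged. *)
Lemma close_out v x0 : l - 2 <= x0 <= r + 2 ->
  (forall y, x0 - 1 <= y <= r + 2 -> ~~ v y) -> suf v (x0 + 1) = 1.
Proof.
move=> h z; rewrite -(suf_end v); apply: suf_skip; [lia|lia|] => x hx.
case f : (free v x).
  rewrite psi_free ?ifF //.
  rewrite [free _ _]freeT ?orbF; [|apply: z; lia..].
  by lia.
apply: psi_out => //.
case: (ltrP (r + 1) x) => //; rewrite ?orbT // orbF => hx2.
by move: f; rewrite freeT //; apply: z; lia.
Qed.

Lemma suf_inner v d f : l <= d -> d + 1 < f -> f <= r + 2 -> v d -> v f ->
  (forall y, d < y < f -> ~~ v y) ->
  suf v (d + 1) = midgap p (absz (f - d - 1)%R) * suf v f.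
Proof.
move=> h1 h2 h3 vd vf z.
have b1 : psi v (d + 1) = q.
  by rewrite psi_bdry ?addrK ?vd //; [apply: z; lia|lia].
rewrite suf_cons ?b1; last by lia.
(* Gaps of one or two sites have no free site and are charged for their boundary sites alone. *)
have [e|e] := eqVneq f (d + 2).
  rewrite e (_ : absz _ = 1%N); last by lia.
  by rewrite midgap1 // -addrA.
rewrite (_ : d + 1 + 1 = d + 2); last by lia.
rewrite suf_cons; last by lia.
have [e3|e3] := eqVneq f (d + 3).
  rewrite psi_bdry; [|by apply: z; lia|by rewrite (_ : d + 2 + 1 = f) -?e3 ?vf ?orbT // e3; lia|lia].
  rewrite (_ : absz _ = 2%N); last by lia.
  rewrite (_ : d + 2 + 1 = f); last by lia.
  by rewrite mulrA midgapE // expr1 mxE.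
rewrite psi_free; last by apply: freeT; apply: z; lia.
rewrite freeNl ?orbT; last by rewrite (_ : d + 2 - 1 - 1 = d) //; lia.
rewrite (@lend_some _ _ (d + 2)) ?(@rend_some _ _ (f - 2)); first 1 last.
- by lia.
- by rewrite freeNr // (_ : f - 2 + 1 + 1 = f) //; lia.
- by move=> y hy; apply: freeT; apply: z; lia.
- by lia.
- by rewrite freeNl // (_ : d + 2 - 1 - 1 = d) //; lia.
- by move=> y hy; apply: freeT; apply: z; lia.
rewrite (@close_in v (d + 2) f) //; [|lia|lia|by move=> y hy; apply: z; lia].
rewrite /ZU (_ : absz (f - d - 1)%R = (absz (f - 2 - (d + 2) + 2)%R).+1); last by lia.
rewrite midgapE //; have : q != 0 by rewrite gt_eqF // subr_gt0.
by move=> qn; field.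
Qed.
Lemma q_neq0 : q != 0.
Proof. by rewrite gt_eqF // subr_gt0. Qed.

Lemma Q1 : (Qmat p ^+ 1) 0 0 = q.
Proof. by rewrite expr1 mxE. Qed.

(** Compared with [midgap] one factor [q] is missing, since the right boundary site [f - 1] lies
    beyond [r + 1]. *)
Lemma suf_last_fin v d f : l <= d -> d <= r -> r + 3 <= f -> v d -> v f ->
  (forall y, d < y < f -> ~~ v y) ->
  suf v (d + 1) = (Qmat p ^+ absz (f - d - 2)%R) 0 0.
Proof.
move=> h1 h2 h3 vd vf z.
rewrite suf_cons; last by lia.
rewrite psi_bdry ?addrK ?vd //; [|by apply: z; lia|lia].
rewrite (_ : d + 1 + 1 = d + 2); last by lia.
rewrite suf_cons; last by lia.
rewrite (@close_out v (d + 2)) ?mulr1; [|lia|by move=> y hy; apply: z; lia].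
have [e|e] := eqVneq f (d + 3).
  rewrite psi_out ?mulr1; [|by rewrite freeNr // (_ : d + 2 + 1 = f) //; lia|lia].
  by rewrite e (_ : absz _ = 1%N) ?Q1 //; lia.
rewrite psi_free; last by apply: freeT; apply: z; lia.
rewrite freeNl ?orbT; last by rewrite (_ : d + 2 - 1 - 1 = d) //; lia.
rewrite (@lend_some _ _ (d + 2)) ?(@rend_some _ _ (f - 2)); first 1 last.
- by lia.
- by rewrite freeNr // (_ : f - 2 + 1 + 1 = f) //; lia.
- by move=> y hy; apply: freeT; apply: z; lia.
- by lia.
- by rewrite freeNl // (_ : d + 2 - 1 - 1 = d) //; lia.
- by move=> y hy; apply: freeT; apply: z; lia.
rewrite /ZU mulVKf ?q_neq0 // (_ : absz (f - 2 - (d + 2) + 2)%R = absz (f - d - 2)%R) //.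
by lia.
Qed.

Lemma suf_last_inf v d : l <= d -> d <= r -> v d -> (forall y, d < y -> ~~ v y) ->
  suf v (d + 1) = lam ^+ absz (r - d)%R.
Proof.
move=> h1 h2 vd z.
rewrite suf_cons; last by lia.
rewrite psi_bdry ?addrK ?vd //; [|by apply: z; lia|lia].
rewrite (_ : d + 1 + 1 = d + 2); last by lia.
rewrite suf_cons; last by lia.
rewrite (@close_out v (d + 2)) ?mulr1; [|lia|by move=> y hy; apply: z; lia].
rewrite psi_free; last by apply: freeT; apply: z; lia.
rewrite freeNl ?orbT; last by rewrite (_ : d + 2 - 1 - 1 = d) //; lia.
rewrite (@lend_some _ _ (d + 2)) ?(@rend_none); first 1 last.
- by move=> y hy; apply: freeT; apply: z; lia.
- by lia.
- by rewrite freeNl // (_ : d + 2 - 1 - 1 = d) //; lia.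
- by move=> y hy; apply: freeT; apply: z; lia.
rewrite /ZU mulVKf ?q_neq0 //; congr (_ ^+ _); lia.
Qed.

(* [lspec v oa t C]: the gap of [v] to the left of [l] has at least two sites;
   [oa] is the left end of its free part, [t] its parameter and [C] the factor
   by which it enters the weight. *)
Inductive lspec v : option int -> R -> R -> Prop :=
| LFin (k : nat) of (1 < k)%N & v (l - 1 - k%:Z) &
    (forall y, l - 1 - k%:Z < y < l -> ~~ v y) :
    lspec v (Some (l + 1 - k%:Z)) (a ^+ k) (lam ^+ k / (lam - rho))
| LInf of (forall y, y < l -> ~~ v y) : lspec v None 0 1.

(** A right gap of one site ([E1]) is kept apart: its boundary site [r + 1] is charged a factor [q],
    whereas for [1 < j] the right boundary site [r + j] is not charged. *)
Inductive rspec v : renv R -> R -> Prop :=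
| E11 of v (r + 1) & v (r + 2) : rspec v (R11 R) p
| E10 of v (r + 1) & ~~ v (r + 2) : rspec v (R10 R) p
| E1 of ~~ v (r + 1) & v (r + 2) :
    rspec v (RZ a) (q * (lam / (lam - rho)))
| EFin (j : nat) of (1 < j)%N & v (r + 1 + j%:Z) &
    (forall y, r < y < r + 1 + j%:Z -> ~~ v y) :
    rspec v (RZ (a ^+ j)) (lam ^+ j / (lam - rho))
| EInf of (forall y, r < y -> ~~ v y) : rspec v (RZ 0) 1.

Lemma lspec0 v oa t C y : lspec v oa t C -> l - 2 <= y < l -> ~~ v y.
Proof. by case=> [k k1 _ z|z] hy; apply: z; lia. Qed.

Lemma gap_neq0 : lam - rho != 0.
Proof. by rewrite gt_eqF // gap_gt0. Qed.

Lemma ratioX_scale (k c : nat) :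
  lam ^+ k / (lam - rho) * leadgap p (a ^+ k) c = (lam ^+ (k + c) - rho ^+ (k + c)) / (lam - rho).
Proof. by rewrite /leadgap !exprD -(lamX_ratio p_gt0 p_lt1 k); ring. Qed.

Lemma suf_tail v s C d : rspec v (RZ s) C -> l <= d -> d <= r -> v d ->
  (forall y, d < y <= r -> ~~ v y) ->
  suf v (d + 1) = C * leadgap p s (absz (r - d)%R).
Proof.
move e : (RZ s) => rz H; case: H e => // [n1 v2 [->]|j j1 vj zj [->]|zj [->]] ld dr vd z.
- rewrite (@suf_inner v d (r + 2)) //; [|lia|]; last first.
    move=> y hy; have [->//|ny] := eqVneq y (r + 1).
    by apply: z; lia.
  rewrite suf_cons; last by lia.
  rewrite (_ : r + 2 + 1 = r + 3); last by lia.
  rewrite suf_end psi_out ?freeN //; [|lia].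
  rewrite (_ : absz (r + 2 - d - 1)%R = (absz (r - d)%R).+1); last by lia.
  rewrite !mulr1 -mulrA; have := ratioX_scale 1 (absz (r - d)%R).
  by rewrite !expr1 => ->; rewrite /midgap /leadgap mul1r add1n; ring.
- rewrite (@suf_last_fin v d (r + 1 + j%:Z)) //; [|lia|]; last first.
    by move=> y hy; have [?|?] := lerP y r; [apply: z|apply: zj]; lia.
  rewrite QpowE // ratioX_scale (_ : (absz (r + 1 + j%:Z - d - 2)%R).+1 = j + absz (r - d)%R)%N //.
  by lia.
- rewrite (@suf_last_inf v d) //; last first.
    by move=> y hy; have [?|?] := lerP y r; [apply: z|apply: zj]; lia.
  by rewrite mul1r /leadgap mul0r subr0.
Qed.

(* The start [x0] of the free part of the left gap inside the window is [l - 1]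
   for a gap of two sites and [l - 2] otherwise. *)
Lemma suf_open v oa t C : lspec v oa t C -> free v (l - 2) || ~~ v l ->
  exists x0, [/\ l - 2 <= x0 <= l - 1, free v x0, ~~ v l \/ x0 = l - 2,
    forall y, x0 - 1 <= y < l -> ~~ v y &
    suf v (l - 2) = ZU p l r oa (rend v x0) * suf v (x0 + 1)].
Proof.
move=> H; have lr' := lr; have z2 := lspec0 H; case: H z2 => [k k1 vk z|z] z2 op.
- have [k2|k2] := eqVneq k 2.
    have nf : free v (l - 2) = false by rewrite freeNl // (_ : _ - 1 = l - 1 - k%:Z) //; lia.
    have nl : ~~ v l by move: op; rewrite nf.
    have fr : free v (l - 1) by apply: freeT; rewrite ?subrK //; apply: z2; lia.
    exists (l - 1); split=> //; [lia|by left|by move=> y hy; apply: z2; lia|].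
    rewrite suf_cons; last by lia.
    rewrite psi_out ?mul1r //; last by lia.
    rewrite (_ : l - 2 + 1 = l - 1); last by lia.
    rewrite suf_cons; last by lia.
    have l2 : l - 1 - 1 = l - 2 by lia.
    rewrite psi_free // l2 nf orbT (@lend_some _ _ (l - 1)) ?l2 ?nf //.
      by congr (ZU _ _ _ (Some _) _ * _); lia.
    by move=> y hy; rewrite (_ : y = l - 1) //; lia.
  have fr : free v (l - 2) by apply: freeT; apply: z; lia.
  exists (l - 2); split=> //; [lia|by right|by move=> y hy; apply: z; lia|].
  rewrite suf_cons; last by lia.
  rewrite psi_free // eqxx /= (@lend_some _ _ (l + 1 - k%:Z)) //; first by lia.
    by rewrite freeNl // (_ : _ - 1 = l - 1 - k%:Z) //; lia.
  by move=> y hy; apply: freeT; apply: z; lia.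
- have fr : free v (l - 2) by apply: freeT; apply: z; lia.
  exists (l - 2); split=> //; [lia|by right|by move=> y hy; apply: z; lia|].
  rewrite suf_cons; last by lia.
  rewrite psi_free // eqxx /= lend_none // => y hy.
  by apply: freeT; apply: z; lia.
Qed.

Lemma suf_head v oa t C f : lspec v oa t C -> l <= f -> f <= r + 2 -> v f ->
  (forall y, l <= y < f -> ~~ v y) ->
  suf v (l - 2) = C * leadgap p t (absz (f - l)%R) * suf v f.
Proof.
move=> H lf fr vf zf; have lr' := lr; have z2 := lspec0 H.
have zz y : l - 2 <= y < f -> ~~ v y.
  by move=> hy; have [?|?] := ltrP y l; [apply: z2|apply: zf]; lia.
case op : (free v (l - 2) || ~~ v l); last first.
  (* Here [k = 2] and [f = l]: the gap has no free site and costs only the [q] of [l - 1], as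
     [l - 2] is not charged. *)
  move: op => /negbT; rewrite negb_or negbK => /andP[nf vl].
  have el : f = l by have [//|?] := eqVneq f l; move: vl; rewrite (negbTE (zf l _)) //; lia.
  case: H nf => [k k1 vk z|z] nf; last first.
    by move: nf; rewrite freeT //; apply: z; lia.
  have k2 : k = 2%N.
    have [//|k2] := eqVneq k 2%N.
    by move: nf; rewrite freeT //; apply: z; lia.
  rewrite suf_cons ?psi_out ?mul1r ?(negbTE nf) //; [|lia|lia].
  rewrite (_ : l - 2 + 1 = l - 1); last by lia.
  rewrite suf_cons ?subrK ?el; last by lia.
  rewrite psi_bdry ?subrK ?vl ?orbT //; [|by apply: z; lia|lia].
  rewrite ratioX_scale subrr k2 -(Q1) QpowE //.
have [x0 [hx fx0 alt zx ->]] := suf_open H op.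
have hf : x0 + 2 <= f.
  case: alt => [nl|->]; last by lia.
  have [e|?] := eqVneq f l; last by lia.
  by move: vf; rewrite e (negbTE nl).
rewrite (@close_in v x0 f) //; [|lia|]; last first.
  by move=> y hy; have [?|?] := ltrP y l; [apply: zx|apply: zf]; lia.
rewrite (@rend_some _ _ (f - 2)); [|lia|..]; first 1 last.
- by rewrite freeNr // (_ : f - 2 + 1 + 1 = f) //; lia.
- move=> y hy; apply: freeT; (have [?|?] := ltrP y l; [idtac|idtac]);
    try (by apply: zf; lia); try (by apply: zx; lia); by apply: zz; lia.
rewrite mulrA; congr (_ * _); have qn := q_neq0.
case: H {op alt} => [k k1 vk z|z] /=.
- rewrite ratioX_scale mulrAC mulVf // mul1r QpowE //.
  by rewrite (_ : (absz (f - 2 - (l + 1 - k%:Z) + 2)%R).+1 = k + absz (f - l)%R)%N //; lia.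
- rewrite mulrAC mulVf // mul1r mul1r /leadgap mul0r subr0.
  by congr (_ ^+ _); lia.
Qed.

Lemma suf_empty v oa t C s C' : lspec v oa t C -> rspec v (RZ s) C' ->
  (forall y, l <= y <= r -> ~~ v y) ->
  suf v (l - 2) = C * C' * ((lam - rho) / q * leadgap p (t * s) (absz (r - l + 1)%R)).
Proof.
move=> H; have lr' := lr; have z2 := lspec0 H.
have qn := q_neq0; have gn := gap_neq0; have ln := lam_nz p_gt0 p_lt1.
have nl : (forall y, l <= y <= r -> ~~ v y) -> ~~ v l by apply; lia.
move e : (RZ s) => rz H2; case: H2 e => // [n1 v2 [->]|j j1 vj zj [->]|zj [->]] z.
(* The one at [r + 2] is still inside the product, so it closes the left gap. *)
- rewrite (@suf_head v oa t C (r + 2)) //; [|lia|]; last first.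
    move=> y hy; have [->//|ny] := eqVneq y (r + 1).
    by apply: z; lia.
  rewrite suf_cons; last by lia.
  rewrite (_ : r + 2 + 1 = r + 3); last by lia.
  rewrite suf_end psi_out ?freeN //; [|lia].
  rewrite (_ : absz (r + 2 - l)%R = (absz (r - l + 1)%R).+1); last by lia.
  rewrite /leadgap !exprS /ratio; field.
  by rewrite ?qn ?gn ?ln.
- have [|x0 [hx fx0 alt zx ->]] := suf_open H; first by rewrite nl // orbT.
  rewrite close_out ?mulr1; [|lia|]; last first.
    move=> y hy; have [?|?] := ltrP y l; first by apply: zx; lia.
    by have [?|?] := lerP y r; [apply: z|apply: zj]; lia.
  rewrite (@rend_some _ _ (r + j%:Z - 1)); [|lia|..]; first 1 last.
  + by rewrite freeNr // (_ : r + j%:Z - 1 + 1 + 1 = r + 1 + j%:Z) //; lia.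
  + have zz y : x0 - 1 <= y < r + 1 + j%:Z -> ~~ v y.
      move=> hy; have [?|?] := ltrP y l; first by apply: zx; lia.
      by have [?|?] := lerP y r; [apply: z|apply: zj]; lia.
    by move=> y hy; apply: freeT; apply: zz; lia.
  case: H {alt} => [k k1 vk zk|zk] /=.
  + rewrite QpowE // (_ : (absz (r + j%:Z - 1 - (l + 1 - k%:Z) + 2)%R).+1 = k + (j + absz (r - l + 1)%R))%N; last by lia.
    rewrite /leadgap !exprD -!(lamX_ratio p_gt0 p_lt1); field.
    by rewrite ?qn ?gn.
  + rewrite (_ : absz _ = (j + absz (r - l + 1)%R)%N); last by lia.
    rewrite mul0r /leadgap mul0r subr0 exprD; field.
    by rewrite ?qn ?gn.
- have [|x0 [hx fx0 alt zx ->]] := suf_open H; first by rewrite nl // orbT.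
  have zz y : x0 - 1 <= y -> ~~ v y.
    move=> hy; have [?|?] := ltrP y l; first by apply: zx; lia.
    by have [?|?] := lerP y r; [apply: z|apply: zj]; lia.
  rewrite close_out ?mulr1; [|lia|by move=> y hy; apply: zz; lia].
  rewrite rend_none; last by move=> y hy; apply: freeT; apply: zz; lia.
  rewrite mulr0 /leadgap mul0r subr0.
  case: H {alt} => [k k1 vk zk|zk] /=.
  + rewrite (_ : absz _ = (k + absz (r - l + 1)%R)%N); last by lia.
    rewrite exprD; field.
    by rewrite ?qn ?gn.
  + rewrite (_ : absz (r + 1 - (l - 1) + 1)%R = (absz (r - l + 1)%R).+2); last by lia.
    rewrite DconstE // !exprS; field.
    by rewrite ?qn ?ln.
Qed.

(** * Identification of the weight with the scan *)

Fixpoint readoff v m (n : nat) : seq bool :=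
  if n is n'.+1 then v m :: readoff v (m + 1) n' else [::].

(** The part of the condition for [Omega'] that concerns sites from [m] on; used as an indicator, it
    lets excluded fillings remain in the sum with weight 0. *)
Definition valid v m : bool :=
  `[< forall x, m <= x -> v x -> v (x - 1) || v (x + 1) >].

Lemma validS v m : valid v m = (v m ==> (v (m - 1) || v (m + 1))) && valid v (m + 1).
Proof.
apply/asboolP/andP => [h|[h1 /asboolP h2] x mx vx].
  by split; [apply/implyP => vm; apply: h|apply/asboolP => x mx; apply: h; lia].
have [e|ne] := eqVneq x m; first by move: h1 vx; rewrite e => /implyP.
by apply: h2 => //; lia.
Qed.

Lemma rspec_R11 v C : rspec v (R11 R) C -> [/\ v (r + 1), v (r + 2) & C = p].
Proof. by move e : (R11 R) => E H; case: H e. Qed.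

Lemma rspec_R10 v C : rspec v (R10 R) C -> [/\ v (r + 1), ~~ v (r + 2) & C = p].
Proof. by move e : (R10 R) => E H; case: H e. Qed.

Lemma rspec_RZ v s C : rspec v (RZ s) C -> ~~ v (r + 1).
Proof.
move e : (RZ s) => E H; case: H e => // [j j1 _ z _|z _]; apply: z; lia.
Qed.

Lemma valid_end v e C : rspec v e C ->
  (forall x, r + 1 < x -> v x -> v (x - 1) || v (x + 1)) ->
  valid v (r + 1) = if e is R10 then v r else true.
Proof.
move=> H ok; have -> : valid v (r + 1) = (v (r + 1) ==> (v r || v (r + 2))).
  rewrite validS addrK -[r + 1 + 1]addrA andb_idr // => _.
  by apply/asboolP => x hx; apply: ok; lia.
case: e H => [/rspec_R11[-> -> _]|/rspec_R10[-> /negbTE-> _]|s /rspec_RZ/negbTE->] //=.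
  by rewrite orbT.
by rewrite orbF.
Qed.

Lemma suf_one_end v : v (r + 1) -> suf v (r + 1) = p.
Proof.
move=> v1; have lr' := lr; rewrite suf_cons; last by lia.
rewrite psi_one //; last by lia.
rewrite (_ : r + 1 + 1 = r + 2); last by lia.
rewrite suf_cons; last by lia.
rewrite psi_out; [|by rewrite freeNl // (_ : r + 2 - 1 = r + 1) //; lia|by lia].
by rewrite (_ : r + 2 + 1 = r + 3) ?suf_end ?mulr1 //; lia.
Qed.

(** Induction from the right end with one invariant per state. After an isolated one, validity
    starts at [m - 1], as that site still needs a successor; inside a gap, the product starts at
    [m - g], where the gap begins, because its factor is not yet charged. *)
Lemma suf_inner_master v e C : rspec v e C ->
  (forall x, r + 1 < x -> v x -> v (x - 1) || v (x + 1)) ->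
  forall (n : nat) m, m + n%:Z = r + 1 ->
  [/\ l < m -> v (m - 1) -> v (m - 2) ->
        (valid v m)%:R * suf v m = C * inner p e Ones (readoff v m n),
      l < m -> v (m - 1) -> ~~ v (m - 2) ->
        (valid v (m - 1))%:R * suf v m = C * inner p e One (readoff v m n) &
      forall g : nat, (0 < g)%N -> l <= m - 1 - g%:Z -> v (m - 1 - g%:Z) ->
        (forall y, m - 1 - g%:Z < y < m -> ~~ v y) ->
        (valid v m)%:R * suf v (m - g%:Z) = C * inner p e (Gap g) (readoff v m n)].
Proof.
move=> H ok; have lr' := lr; elim=> [|n IH] m em.
  have {em} -> : m = r + 1 by lia.
  have e1 : r + 1 - 1 = r by lia.
  have e2 : r + 1 - 2 = r - 1 by lia.
  rewrite e1 e2 [valid v r]validS (valid_end H ok).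
  split=> [lm v1 v2|lm v1 v2|g g0 ld vd z].
  - case: e H => [/rspec_R11[h1 h2 ->]|/rspec_R10[h1 h2 ->]|s H] /=.
    + by rewrite suf_one_end // mul1r mulr1.
    + by rewrite suf_one_end // v1 mul1r mulr1.
    + rewrite mul1r (suf_tail H) //; last by move=> y; lia.
      by rewrite subrr /leadgap !expr0 mulr1.
  - rewrite v1 (negbTE v2) /=.
    case: e H => [/rspec_R11[h1 h2 ->]|/rspec_R10[h1 h2 ->]|s H] /=.
    + by rewrite h1 suf_one_end // mul1r mulr1.
    + by rewrite h1 suf_one_end // mul1r mulr1.
    + by rewrite (negbTE (rspec_RZ H)) mul0r mulr0.
  - rewrite (_ : r + 1 - g%:Z = r - g%:Z + 1); last by lia.
    case: e H => [/rspec_R11[h1 h2 ->]|/rspec_R10[h1 h2 ->]|s H] /=.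
    + rewrite (@suf_inner v (r - g%:Z) (r + 1)) //; [|lia|lia].
      rewrite suf_one_end // mul1r mulrC; congr (_ * midgap _ _); lia.
    + by rewrite (negbTE (z r _)) ?mul0r ?mulr0 //; lia.
    + rewrite mul1r (suf_tail H) //; [|lia|by move=> y hy; apply: z; lia].
      by congr (_ * leadgap _ _ _); lia.
have [IHa IHb IHc] : _ := IH (m + 1) ltac:(lia).
have e1 : m + 1 - 1 = m by lia.
have e2 : m + 1 - 2 = m - 1 by lia.
rewrite e1 e2 in IHa IHb IHc.
split=> [lm v1 v2|lm v1 v2|g g0 ld vd z] /=.
- rewrite validS v1 implybT /=; case vm : (v m) => /=.
    rewrite suf_cons ?psi_one //; [|lia|lia].
    by rewrite mulrCA IHa //; [ring|lia].
  have := IHc 1%N isT; rewrite -addrA subrr addr0 mul1r; apply => //; first by lia.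
  by move=> y hy; rewrite (_ : y = m) ?vm //; lia.
- rewrite validS v1 (_ : m - 1 - 1 = m - 2) ?(negbTE v2) ?subrK /=; last by lia.
  case vm : (v m) => /=; last by rewrite mul0r mul0r mulr0.
  rewrite validS v1 implybT /=.
  rewrite suf_cons ?psi_one //; [|lia|lia].
  by rewrite mulrCA IHa //; [ring|lia].
- case vm : (v m) => /=; last first.
    rewrite validS vm /= mul1r.
    have := IHc g.+1 isT; rewrite (_ : m - g.+1%:Z = m - 1 - g%:Z); last by lia.
    rewrite (_ : m + 1 - g.+1%:Z = m - g%:Z); last by lia.
    apply => // y hy.
    by have [->|ny] := eqVneq y m; [rewrite vm|apply: z; lia].
  have nv : ~~ v (m - 1) by apply: z; lia.
  have -> : m - g%:Z = m - 1 - g%:Z + 1 by lia.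
  rewrite (@suf_inner v (m - 1 - g%:Z) m) //; [|lia|lia].
  rewrite suf_cons ?psi_one //; [|lia|lia].
  rewrite (_ : absz (m - (m - 1 - g%:Z) - 1)%R = g); last by lia.
  have := IHb ltac:(lia) vm nv => {IHa IHb IHc} IHb.
  rewrite [LHS](_ : _ = midgap p g * p * ((valid v m)%:R * suf v (m + 1))); last by ring.
  by rewrite IHb; ring.
Qed.

Lemma suf_lead_master v oa t Cl e C : lspec v oa t Cl -> rspec v e C ->
  (forall x, r + 1 < x -> v x -> v (x - 1) || v (x + 1)) ->
  forall (n c : nat), l + c%:Z + n%:Z = r + 1 ->
  (forall y, l <= y < l + c%:Z -> ~~ v y) ->
  (valid v (l + c%:Z))%:R * suf v (l - 2) =
    Cl * C * lead p e t c (readoff v (l + c%:Z) n).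
Proof.
move=> HL H ok; have lr' := lr; elim=> [|n IH] c ec z /=.
  have em : l + c%:Z = r + 1 by lia.
  rewrite em (valid_end H ok).
  case: e H => [/rspec_R11[h1 h2 ->]|/rspec_R10[h1 h2 ->]|s H] /=.
  - rewrite (suf_head HL _ _ h1) ?suf_one_end ?mul1r //; [|lia|lia|]; last first.
      by move=> y hy; apply: z; lia.
    by rewrite (_ : absz (r + 1 - l)%R = c); [ring|lia].
  - by rewrite (negbTE (z r _)) ?mul0r ?mulr0 //; lia.
  - rewrite mul1r (suf_empty HL H); last by move=> y hy; apply: z; lia.
    by rewrite (_ : absz (r - l + 1)%R = c) //; lia.
case vm : (v (l + c%:Z)); last first.
  rewrite validS vm /= (_ : l + c%:Z + 1 = l + c.+1%:Z); last by lia.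
  rewrite IH //; first by lia.
  move=> y hy; have [->|ny] := eqVneq y (l + c%:Z); first by rewrite vm.
  by apply: z; lia.
have nv : ~~ v (l + c%:Z - 1).
  by case: c z vm ec => [|c] z vm ec; [apply: (lspec0 HL); lia|apply: z; lia].
rewrite (suf_head HL _ _ vm) //; [|lia|lia].
rewrite suf_cons ?psi_one //; [|lia|lia].
rewrite (_ : absz (l + c%:Z - l)%R = c); last by lia.
have [_ IHb _] := suf_inner_master H ok (m := l + c%:Z + 1) (n := n) ltac:(lia).
move: IHb; rewrite addrK (_ : l + c%:Z + 1 - 2 = l + c%:Z - 1); last by lia.
move=> /(_ ltac:(lia) vm nv) IHb.
rewrite [LHS](_ : _ = Cl * (leadgap p t c * p) * ((valid v (l + c%:Z))%:R * suf v (l + c%:Z + 1))); last by ring.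
by rewrite IHb; ring.
Qed.

Lemma Omega'_valid v : (forall x, x < l -> v x -> v (x - 1) || v (x + 1)) ->
  `[< Omega' v >] = valid v l.
Proof.
move=> ok; apply/asboolP/asboolP => [/Omega'P h x _|h]; first exact: h.
by apply/Omega'P => x; have [?|?] := ltrP x l; [apply: ok|apply: h].
Qed.

Lemma weight_master v oa t Cl e C : lspec v oa t Cl -> rspec v e C ->
  (forall x, x < l -> v x -> v (x - 1) || v (x + 1)) ->
  (forall x, r + 1 < x -> v x -> v (x - 1) || v (x + 1)) ->
  (`[< Omega' v >])%:R * weight p l r v =
    Cl * C * lead p e t 0 (readoff v l (absz (r - l + 1)%R)).
Proof.
move=> HL H okl ok; have lr' := lr; rewrite Omega'_valid // weightE.
have := suf_lead_master HL H ok (n := absz (r - l + 1)%R) (c := 0%N).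
by rewrite addr0; apply; [lia|move=> y; lia].
Qed.

Lemma lspec_out v w oa t C : (forall y, y < l -> v y = w y) ->
  lspec w oa t C -> lspec v oa t C.
Proof.
clear p_gt0 p_lt1 lr.
move=> h [k k1 vk z|z]; constructor => //.
- by rewrite h //; lia.
- by move=> y hy; rewrite h ?z //; lia.
- by move=> y hy; rewrite h ?z.
Qed.

Lemma rspec_out v w e C : (forall y, r < y -> v y = w y) ->
  rspec w e C -> rspec v e C.
Proof.
clear p_gt0 p_lt1 lr.
move=> h [a1 a2|a1 a2|a1 a2|j j1 a1 z|z]; constructor => //;
  try (by rewrite h //; lia); by move=> y hy; rewrite h ?z //; lia.
Qed.

Lemma size_readoff v m (n : nat) : size (readoff v m n) = n.
Proof. by elim: n m => //= n IH m; rewrite IH. Qed.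

Lemma nth_readoff v m (n i : nat) :
  (i < n)%N -> nth false (readoff v m n) i = v (m + i%:Z).
Proof.
elim: n m i => // n IH m [|i] ik /=; first by rewrite addr0.
by rewrite IH //; congr v; lia.
Qed.

Lemma readoff_ffconf (xi : {ffun 'I_(absz (r - l + 1)%R) -> bool}) w :
  readoff (glue l r (ffconf l r xi) w) l (absz (r - l + 1)%R) = codom xi.
Proof.
have lr' := lr; set n := absz (r - l + 1)%R in xi *.
apply: (@eq_from_nth _ false).
  by rewrite size_codom card_ord size_readoff.
move=> i; rewrite size_readoff => hi; rewrite nth_readoff // /glue ifT; last by lia.
rewrite /ffconf (_ : absz (l + i%:Z - l)%R = i); last by lia.
rewrite insubT codomE (nth_map (Ordinal hi)) ?size_enum_ord //.
by congr (xi _); apply: val_inj; rewrite /= nth_enum_ord.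
Qed.

(** The factor [Cl * C] is determined by the sites outside the window, hence the same for all
    fillings, and cancels. *)
Lemma gammaE w oa t Cl e C : Omega' w -> lspec w oa t Cl -> rspec w e C ->
  0 < Cl -> 0 < C ->
  gammaI p l r w = lead p e t 0 (readoff w l (absz (r - l + 1)%R)) /
    lsum (absz (r - l + 1)%R) (lead p e t 0).
Proof.
move=> Ow HL H Cl0 C0; have lr' := lr; move/Omega'P: (Ow) => ok.
have lsz := lspec0 HL.
have main v : (forall y, (y < l) || (r < y) -> v y = w y) ->
  (`[< Omega' v >])%:R * weight p l r v =
    Cl * C * lead p e t 0 (readoff v l (absz (r - l + 1)%R)).
  move=> h; apply: weight_master.
  - by apply: lspec_out HL => y hy; rewrite h // hy.
  - by apply: rspec_out H => y hy; rewrite h // hy orbT.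
  (* The left gap has at least two sites, so the neighbours of an occupied [x < l] also lie outside
     the window. *)
  - move=> x xl; rewrite h ?xl // => wx.
    have xl2 : x < l - 2.
      by have [//|hx] := ltrP x (l - 2); move: wx; rewrite (negbTE (lsz _ _)) //; lia.
    by rewrite !h ?ok //; lia.
  - by move=> x xr; rewrite !h; [exact: ok|lia..].
rewrite /gammaI; move/asboolP: (Ow) => Owb; rewrite Owb.
have := main w (fun _ _ => erefl); rewrite Owb mul1r => ->.
rewrite big_mkcond /= (eq_bigr (fun xi : {ffun 'I_(absz (r - l + 1)%R) -> bool} =>
   Cl * C * lead p e t 0 (codom xi))) => [|xi _]; last first.
  rewrite -(readoff_ffconf xi w) -main ?/glue; last by move=> y hy; rewrite ifF //; lia.
  by case: ifP => _; rewrite ?mul1r ?mul0r.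
rewrite -mulr_sumr -mulf_div divff ?mul1r // gt_eqF // mulr_gt0 //.
Qed.
End Weight.

(** * Invariance under reflection *)

Definition flip (w : config) : config := fun x => w (- x).

Lemma flipK w : flip (flip w) = w.
Proof. by apply: funext => x; rewrite /flip opprK. Qed.

Lemma Omega'_flip w : Omega' w -> Omega' (flip w).
Proof.
move=> /Omega'P h; apply/Omega'P => x /h; rewrite /flip orbC.
rewrite (_ : - (x - 1) = - x + 1); last by lia.
by rewrite (_ : - (x + 1) = - x - 1) //; lia.
Qed.

Lemma free_flip w x : free (flip w) x = free w (- x).
Proof.
rewrite /free /flip (_ : - (x - 1) = - x + 1); last by lia.
rewrite (_ : - (x + 1) = - x - 1); last by lia.
by case: (w _) (w _) (w _) => [] [] [].
Qed.

Lemma bdry_flip w x : bdry (flip w) x = bdry w (- x).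
Proof.
rewrite /bdry /flip (_ : - (x - 1) = - x + 1); last by lia.
by rewrite (_ : - (x + 1) = - x - 1) 1?orbC //; lia.
Qed.

Lemma lend_flip w x : lend (flip w) x = omap -%R (rend w (- x)).
Proof.
rewrite /rend; case: pselect => [H|nH] /=.
  case: cid => b /= [xb [nb fb]]; apply: lend_some; first by lia.
    by rewrite free_flip (_ : - (- b - 1) = b + 1) //; lia.
  by move=> y hy; rewrite free_flip fb //; lia.
rewrite /lend; case: pselect => [H|//]; case: nH; case: H => a [ax [na fa]].
exists (- a); split; first by lia.
split; first by move: na; rewrite free_flip (_ : - (a - 1) = - a + 1) //; lia.
by move=> y hy; have := fa (- y); rewrite free_flip opprK; apply; lia.
Qed.

Lemma rend_flip w x : rend (flip w) x = omap -%R (lend w (- x)).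
Proof.
by rewrite -[w in lend w]flipK lend_flip opprK; case: rend => //= y; rewrite opprK.
Qed.

Lemma ZU_flip (R : realType) (p : R) (l r : int) (oa ob : option int) :
  ZU p (- r) (- l) (omap -%R ob) (omap -%R oa) = ZU p l r oa ob.
Proof.
case: oa ob => [a|] [b|] /=.
- by rewrite (_ : absz (- a - - b + 2)%R = absz (b - a + 2)%R) //; lia.
- by congr (_ * _ ^+ _); lia.
- by congr (_ * _ ^+ _); lia.
- by congr (_ * _ ^+ _); lia.
Qed.

Lemma uniq_window (a b : int) : uniq (window a b).
Proof. by rewrite map_inj_uniq ?iota_uniq // => i j /addrI[]. Qed.

Lemma perm_window_opp (a b : int) : a <= b + 1 ->
  perm_eq (window (- b) (- a)) (map -%R (window a b)).
Proof.
move=> ab; apply: uniq_perm; first exact: uniq_window.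
  by rewrite map_inj_uniq ?uniq_window //; exact: oppr_inj.
move=> x; rewrite -[x]opprK mem_map; last exact: oppr_inj.
by rewrite !mem_window; lia.
Qed.

(** Reflection turns the leftmost site of a component, where [weight] charges it, into the rightmost
    one. In the induction on prefixes, [M] holds the runs already closed and the run still open is a
    separate factor. *)
Lemma prod_runs (R : realType) (f : int -> bool) (Z : int -> R) (A B : int) :
  A <= B -> (forall x, f x -> f (x + 1) -> Z x = Z (x + 1)) ->
  \prod_(x <- window A B | f x && ((x == A) || ~~ f (x - 1))) Z x =
  \prod_(x <- window A B | f x && ((x == B) || ~~ f (x + 1))) Z x.
Proof.
move=> AB hZ; pose M b := \prod_(x <- window A b | f x && ~~ f (x + 1)) Z x.
have split1 b (P : int -> bool) : A <= b ->
    \prod_(x <- window A b | P x) Z x =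
    \prod_(x <- window A (b - 1) | P x) Z x * (if P b then Z b else 1).
  move=> Ab; rewrite -{1}[b](subrK 1) window_rcons; last by lia.
  by rewrite subrK big_rcons /=; case: (P b); rewrite ?mulr1 1?mulrC.
suff left (n : nat) : \prod_(x <- window A (A + n%:Z) | f x && ((x == A) || ~~ f (x - 1))) Z x =
    M (A + n%:Z - 1) * (if f (A + n%:Z) then Z (A + n%:Z) else 1).
  have -> : B = A + (absz (B - A)%R)%:Z by lia.
  rewrite left split1; last by lia.
  rewrite eqxx /= andbT; congr (_ * _).
  rewrite /M big_seq_cond [RHS]big_seq_cond; apply: eq_bigl => x.
  case hx : (x \in _) => //=; move: hx; rewrite mem_window; last by lia.
  by move=> hx; rewrite (_ : (x == _) = false) //; lia.
elim: n => [|n IH].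
  have := window_nil (A - 1); rewrite subrK => wn.
  rewrite split1 ?addr0 // /M wn !big_nil.
  by rewrite eqxx andbT.
rewrite split1; last by lia.
have -> : A + n.+1%:Z - 1 = A + n%:Z by lia.
rewrite IH (_ : (A + n.+1%:Z == A) = false); last by lia.
rewrite /M [in RHS]split1; last by lia.
have -> : A + n.+1%:Z = A + n%:Z + 1 by lia.
rewrite -!mulrA; congr (_ * _); have := hZ (A + n%:Z).
case: (f _) (f _) => [] [] //= h; rewrite ?mulr1 ?mul1r //.
by rewrite h.
Qed.

Lemma lend_succ w x : free w x -> free w (x + 1) -> lend w x = lend w (x + 1).
Proof.
move=> f1 f2; rewrite {1}/lend; case: pselect => [H|nH].
  case: cid => b /= [xb [nb fb]]; symmetry; apply: lend_some => //; first by lia.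
  by move=> y hy; have [->//|ny] := eqVneq y (x + 1); apply: fb; lia.
rewrite /lend; case: pselect => [H|//]; case: nH; case: H => b [xb [nb fb]].
have [e|ne] := eqVneq b (x + 1); first by move: nb; rewrite e addrK f1.
by exists b; split; [lia|split=> // y hy; apply: fb; lia].
Qed.

Lemma rend_succ w x : free w x -> free w (x + 1) -> rend w x = rend w (x + 1).
Proof.
move=> f1 f2; have := @lend_succ (flip w) (- (x + 1)).
rewrite !free_flip !lend_flip opprK (_ : - (- (x + 1) + 1) = x); last by lia.
move=> /(_ f2 f1); case: rend => [u|]; case: rend => [u'|] //= [].
by move=> /oppr_inj ->.
Qed.

Lemma weight_flip (R : realType) (p : R) (l r : int) w : l <= r ->
  weight p (- r) (- l) (flip w) = weight p l r w.
Proof.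
move=> lr; rewrite /weight.
have e1 : - r - 1 = - (r + 1) by lia.
have e2 : - l + 1 = - (l - 1) by lia.
have e3 : - r - 2 = - (r + 2) by lia.
have e4 : - l + 2 = - (l - 2) by lia.
rewrite e1 e2 e3 e4.
have pw1 : perm_eq (window (- (r + 1)) (- (l - 1))) (map -%R (window (l - 1) (r + 1))).
  by apply: perm_window_opp; lia.
have pw2 : perm_eq (window (- (r + 2)) (- (l - 2))) (map -%R (window (l - 2) (r + 2))).
  by apply: perm_window_opp; lia.
rewrite !(seq.permP pw1) !count_map (perm_big _ pw2) big_map /=.
rewrite [in RHS]prod_runs; [|lia|]; last first.
  by move=> x f1 f2; rewrite lend_succ // rend_succ.
congr (_ ^+ _ * _ ^+ _ * _).
- by apply: eq_count => x /=; rewrite /flip opprK.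
- by apply: eq_count => x /=; rewrite bdry_flip opprK.
- apply: eq_big => [x|x _].
    rewrite !free_flip opprK eqr_opp (_ : - (- x - 1) = x + 1) //; lia.
  by rewrite lend_flip rend_flip opprK ZU_flip.
Qed.

Lemma glue_flip (l r : int) (xi : {ffun 'I_(absz (r - l + 1)%R) -> bool})
    (e : absz (- l - - r + 1)%R = absz (r - l + 1)%R) w : l <= r ->
  glue (- r) (- l)
    (ffconf (- r) (- l) [ffun i => xi (rev_ord (cast_ord e i))]) (flip w) =
  flip (glue l r (ffconf l r xi) w).
Proof.
move=> lr; apply: funext => x; rewrite /glue /flip.
rewrite (_ : (l <= - x) && (- x <= r) = (- r <= x) && (x <= - l)); last by lia.
case: ifP => // hx; rewrite /ffconf.
have h1 : (absz (x - - r)%R < absz (- l - - r + 1)%R)%N by lia.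
have h2 : (absz (- x - l)%R < absz (r - l + 1)%R)%N by lia.
rewrite !insubT ffunE; congr (xi _); apply: val_inj => /=; lia.
Qed.

Lemma gamma_flip (R : realType) (p : R) (l r : int) w : l <= r ->
  gammaI p (- r) (- l) (flip w) = gammaI p l r w.
Proof.
move=> lr; rewrite /gammaI.
have Oflip v : `[< Omega' (flip v) >] = `[< Omega' v >].
  by apply/asboolP/asboolP => [/Omega'_flip|]; rewrite ?flipK //; exact: Omega'_flip.
have e : absz (- l - - r + 1)%R = absz (r - l + 1)%R by lia.
rewrite Oflip; case: ifP => // _; rewrite weight_flip //; congr (_ / _).
pose h (xi : {ffun 'I_(absz (r - l + 1)%R) -> bool}) :
  {ffun 'I_(absz (- l - - r + 1)%R) -> bool} := [ffun i => xi (rev_ord (cast_ord e i))].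
pose k (xi : {ffun 'I_(absz (- l - - r + 1)%R) -> bool}) :
  {ffun 'I_(absz (r - l + 1)%R) -> bool} := [ffun i => xi (cast_ord (esym e) (rev_ord i))].
rewrite (reindex h); last first.
  exists k => xi _; apply/ffunP => i; rewrite !ffunE.
    by rewrite cast_ordKV rev_ordK.
  by rewrite rev_ordK cast_ordK.
by apply: eq_big => [xi|xi _]; rewrite glue_flip // ?Oflip ?weight_flip.
Qed.

(** * Screening by an occupied site *)

Lemma lend_ext w w' x :
  (forall a, [/\ a <= x, ~~ free w (a - 1) & forall y, a <= y <= x -> free w y] <->
             [/\ a <= x, ~~ free w' (a - 1) & forall y, a <= y <= x -> free w' y]) ->
  lend w x = lend w' x.
Proof.
move=> h; rewrite {1}/lend; case: pselect => [H|nH].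
  case: cid => b /= [h1 [h2 h3]].
  by have [|*] := (h b).1; [split|symmetry; apply: lend_some].
rewrite /lend; case: pselect => [H|//]; case: nH; case: H => b [h1 [h2 h3]].
by have [|*] := (h b).2; [split|exists b].
Qed.

Lemma rend_ext w w' x : (forall y, x <= y -> free w y = free w' y) ->
  rend w x = rend w' x.
Proof.
move=> h; rewrite {1}/rend; case: pselect => [H|nH].
  case: cid => b /= [h1 [h2 h3]]; symmetry; apply: rend_some => //.
    by rewrite -h //; lia.
  by move=> y hy; rewrite -h ?h3 //; lia.
rewrite /rend; case: pselect => [H|//]; case: nH; case: H => b [h1 [h2 h3]].
exists b; split=> //; split; first by rewrite h //; lia.
by move=> y hy; rewrite h ?h3 //; lia.
Qed.

(** The site [i] and its neighbours are never free, so every component that is charged starts to the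
    right of [i + 1], where both configurations agree. This also settles [free] at [i - 1], although
    it may involve a site left of [L]. *)
Lemma weight_screen (R : realType) (p : R) (l r L i : int) (v v' : config) :
  l <= r -> L <= l - 2 -> L <= i -> i < l -> v i ->
  (forall x, L <= x -> v x = v' x) -> weight p l r v = weight p l r v'.
Proof.
move=> lr Ll Li il vi h; have vi' : v' i by rewrite -h.
have fi (u : config) x : u i -> i - 1 <= x <= i + 1 -> free u x = false.
  move=> ui hx; have [e|ne] := eqVneq x i; first by rewrite freeN // e.
  have [e|ne2] := eqVneq x (i + 1); first by rewrite freeNl // e addrK.
  by rewrite freeNr // (_ : x + 1 = i) //; lia.
have hf x : i - 1 <= x -> free v x = free v' x.
  move=> ix; have [hx|hx] := lerP x (i + 1); first by rewrite !fi //; lia.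
  by rewrite /free !h //; lia.
rewrite /weight; congr (_ ^+ _ * _ ^+ _ * _).
- by apply: eq_in_count => x; rewrite mem_window => [hx|]; [rewrite h //|]; lia.
- apply: eq_in_count => x; rewrite mem_window => [hx|]; last by lia.
  by rewrite /bdry !h //; lia.
- rewrite big_seq_cond [RHS]big_seq_cond; apply: eq_big => [x|x /andP[]].
    case hx : (x \in _) => //=; move: hx; rewrite mem_window; last by lia.
    move=> hx; rewrite hf; last by lia.
    have [e|ne] //= := eqVneq x (l - 2); by rewrite hf //; lia.
  rewrite mem_window; last by lia.
  move=> hx /andP[fx _].
  have xi : i + 1 < x.
    by have [hx2|//] := lerP x (i + 1); move: fx; rewrite fi //; lia.
  congr (ZU _ _ _ _ _); last by apply: rend_ext => y hy; apply: hf; lia.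
  apply: lend_ext => b; split=> -[h1 h2 h3].
    have bi : i + 1 < b.
      by have [hb|//] := lerP b (i + 1); have := h3 (i + 1); rewrite fi //; lia.
    by split=> // [|y hy]; [rewrite -hf //|rewrite -hf ?h3 //]; lia.
  have bi : i + 1 < b.
    by have [hb|//] := lerP b (i + 1); have := h3 (i + 1); rewrite fi //; lia.
  by split=> // [|y hy]; [rewrite hf //|rewrite hf ?h3 //]; lia.
Qed.

Lemma Omega'_glue_ext (l r L : int) xi w w' : L <= l - 2 -> Omega' w' ->
  (forall x, L <= x -> w x = w' x) -> Omega' (glue l r xi w) -> Omega' (glue l r xi w').
Proof.
move=> Ll /Omega'P ok h /Omega'P og; apply/Omega'P => x.
have [xl|xl] := lerP (l - 1) x.
  have e y : x - 1 <= y -> glue l r xi w' y = glue l r xi w y.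
    by move=> hy; rewrite /glue h //; lia.
  by rewrite !e //; [exact: og|lia|lia].
by rewrite /glue !ifF; [exact: ok|lia..].
Qed.

Lemma gamma_screen (R : realType) (p : R) (l r L i : int) (w w' : config) :
  l <= r -> L <= l - 2 -> L <= i -> i < l -> w i -> Omega' w -> Omega' w' ->
  (forall x, L <= x -> w x = w' x) -> gammaI p l r w = gammaI p l r w'.
Proof.
move=> lr Ll Li il wi Ow Ow' h; rewrite /gammaI.
move/asboolP: (Ow) => ->; move/asboolP: (Ow') => ->.
rewrite (@weight_screen _ p l r L i w w') //; congr (_ / _).
apply: eq_big => [xi|xi _].
  by apply/asboolP/asboolP; apply: Omega'_glue_ext Ll _ _ => // x hx; rewrite h.
apply: (@weight_screen _ p l r L i) => //; first by rewrite /glue ifF //; lia.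
by move=> x hx; rewrite /glue h.
Qed.

(** * Dependence on one side of the window *)

Section Dependence.
Variables (R : realType) (p : R).
Hypotheses (p_gt0 : 0 < p) (p_lt1 : p < 1).
Local Notation lam := (lamPF p).
Local Notation rho := (lamr p).
Local Notation q := (1 - p).
Local Notation a := (ratio p).

Lemma env_okX (j : nat) : (0 < j)%N -> env_ok p (RZ (a ^+ j)).
Proof.
have a0 := ratio_lt0 p_gt0 p_lt1; have a1 := ratio_gtN1 p_gt0 p_lt1.
case: j => [|[|j]] // _ /=; first by rewrite expr1 lexx /=; nra.
have := norm_ratioX_anti p_gt0 p_lt1 (isT : (2 <= j.+2)%N).
rewrite real_normK ?num_real // ler_norml => /andP[h1 h2].
by rewrite h2 andbT (le_trans _ h1) //; nra.
Qed.

Lemma env_ok0 : env_ok p (RZ 0).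
Proof. by rewrite /= sqr_ge0 (ltW (ratio_lt0 p_gt0 p_lt1)). Qed.

Lemma lspec_ex (l L : int) (w : config) : L <= l - 2 ->
  (forall y, L <= y < l -> ~~ w y) ->
  exists oa t C, [/\ lspec p l w oa t C, 0 < C & `|t| <= `|a| ^+ absz (l - L)%R].
Proof.
move=> Ll z; have lam0 := lam_gt0 p_gt0 p_lt1; have g0 := gap_gt0 p_gt0 p_lt1.
have [ex|none] := pselect (exists k : nat, w (l - 1 - k%:Z)).
  case: (ex_minnP ex) => k wk mk.
  have kL : (absz (l - L)%R <= k)%N.
    by rewrite leqNgt; apply/negP => h; move: wk; rewrite (negbTE (z _ _)) //; lia.
  exists (Some (l + 1 - k%:Z)), (a ^+ k), (lam ^+ k / (lam - rho)); split.
  - apply: LFin => //; first by lia.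
    move=> y hy; apply/negP => wy; have := mk (absz (l - 1 - y)%R).
    by rewrite (_ : l - 1 - _ = y) => [/(_ wy)|]; lia.
  - by rewrite divr_gt0 ?exprn_gt0.
  - exact: norm_ratioX_anti.
exists None, 0, 1; split=> //; last by rewrite normr0 exprn_ge0.
apply: LInf => y hy; apply/negP => wy; apply: none; exists (absz (l - 1 - y)%R).
by rewrite (_ : l - 1 - _ = y) //; lia.
Qed.

Lemma rspec_ex (r : int) (w : config) :
  exists e C, [/\ rspec p r w e C, 0 < C & env_ok p e].
Proof.
have lam0 := lam_gt0 p_gt0 p_lt1; have g0 := gap_gt0 p_gt0 p_lt1.
have [ex|none] := pselect (exists k : nat, w (r + 1 + k%:Z)); last first.
  exists (RZ 0), 1; split=> //; last exact: env_ok0.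
  apply: EInf => y hy; apply/negP => wy; apply: none; exists (absz (y - r - 1)%R).
  by rewrite (_ : r + 1 + _ = y) //; lia.
case: (ex_minnP ex) => -[|[|k]] wk mk.
- rewrite addr0 in wk; case w2 : (w (r + 2)).
    by exists (R11 R), p; split=> //; apply: E11.
  by exists (R10 R), p; split=> //; apply: E10; rewrite ?w2.
- exists (RZ a), (q * (lam / (lam - rho))); split.
  + apply: E1; last by rewrite (_ : r + 2 = r + 1 + 1) //; lia.
    by apply/negP => w1; have := mk 0%N; rewrite addr0 w1 => /(_ isT).
  + by apply: mulr_gt0; [rewrite subr_gt0|exact: divr_gt0].
  + by rewrite -[a]expr1; exact: env_okX.
- exists (RZ (a ^+ k.+2)), (lam ^+ k.+2 / (lam - rho)); split.
  + apply: EFin => // y hy; apply/negP => wy; have := mk (absz (y - r - 1)%R).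
    by rewrite (_ : r + 1 + _ = y) => [/(_ wy)|]; lia.
  + by rewrite divr_gt0 ?exprn_gt0.
  + exact: env_okX.
Qed.

Lemma readoff_ext (v w : config) (m : int) (n : nat) :
  (forall x, m <= x < m + n%:Z -> v x = w x) -> readoff v m n = readoff w m n.
Proof.
elim: n m => //= n IH m h; rewrite h; last by lia.
by rewrite IH // => x hx; apply: h; lia.
Qed.

Lemma gamma_left_step (b : R) (l r L : int) (w w' : config) :
  l <= r -> L <= l - 2 -> lam <= b -> p <= b -> Omega' w -> Omega' w' ->
  (forall x, L <= x -> w x = w' x) ->
  `|gammaI p l r w - gammaI p l r w'| <=
    12 / q ^+ 2 * b ^+ absz (r - l + 1)%R * `|a| ^+ absz (l - L)%R.
Proof.
move=> lr Ll lb pb Ow Ow' h.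
have b0 : 0 <= b by apply: le_trans pb; rewrite ltW.
(* Either a common one screens the difference, or both left gaps have at least [l - L] sites. *)
have [[i [/andP[Li il] wi]]|none] := pselect (exists i, L <= i < l /\ w i).
  rewrite (@gamma_screen _ p l r L i w w') // subrr normr0.
  by rewrite !mulr_ge0 ?exprn_ge0 ?invr_ge0 ?sqr_ge0.
have z y : L <= y < l -> ~~ w y by move=> hy; apply/negP => wy; apply: none; exists y.
have z' y : L <= y < l -> ~~ w' y by move=> hy; rewrite -h ?z //; lia.
have [oa [t [Cl [HL Cl0 ht]]]] := lspec_ex Ll z.
have [oa' [t' [Cl' [HL' Cl0' ht']]]] := lspec_ex Ll z'.
have [e [C [H C0 he]]] := rspec_ex r w.
have H' : rspec p r w' e C by apply: rspec_out H => y hy; rewrite h //; lia.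
rewrite (gammaE p_gt0 p_lt1 lr Ow HL H) // (gammaE p_gt0 p_lt1 lr Ow' HL' H') //.
rewrite (@readoff_ext w' w) => [|x hx]; last by rewrite h //; lia.
have -> : absz (r - l + 1)%R = (absz (r - l)%R).+1 by lia.
apply: lead_ratio_diff => //; first by rewrite size_readoff.
by lia.
Qed.

(** A left gap of exactly [l - L] zeros is compared with an infinite one, that is
    [t = a ^+ absz (l - L)] with [t = 0]. *)
Lemma gamma_pair_left (l r L : int) : l <= r -> L <= l - 2 ->
  exists w w' : config, [/\ Omega' w, Omega' w', forall x, L <= x -> w x = w' x &
    Num.sqrt q / 6 * p ^+ absz (r - l + 1)%R * `|a| ^+ absz (l - L)%R <=
    `|gammaI p l r w - gammaI p l r w'|].
Proof.
move=> lr Ll.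
pose w : config := fun x => (x < L) || (l <= x).
pose w' : config := fun x => l <= x.
have Ow : Omega' w.
  by apply/Omega'P => x; rewrite /w; lia.
have Ow' : Omega' w' by apply/Omega'P => x; rewrite /w'; lia.
exists w, w'; split=> //; first by move=> x hx; rewrite /w /w'; lia.
have HL : lspec p l w (Some (l + 1 - (absz (l - L)%R)%:Z)) (a ^+ absz (l - L)%R)
    (lam ^+ absz (l - L)%R / (lam - rho)).
  by apply: LFin; [lia|rewrite /w; lia|move=> y hy; rewrite /w; lia].
have HL' : lspec p l w' None 0 1 by apply: LInf => y hy; rewrite /w'; lia.
have H : rspec p r w (R11 R) p by apply: E11; rewrite /w; lia.
have H' : rspec p r w' (R11 R) p by apply: E11; rewrite /w'; lia.
have C0 : 0 < lam ^+ absz (l - L)%R / (lam - rho).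
  by rewrite divr_gt0 ?exprn_gt0 ?gap_gt0 ?lam_gt0.
rewrite (gammaE p_gt0 p_lt1 lr Ow HL H) // (gammaE p_gt0 p_lt1 lr Ow' HL' H') //.
have rd (v : config) m n : (forall x, m <= x -> v x) -> readoff v m n = nseq n true.
  by elim: n m => //= n IH m hv; rewrite hv // IH // => x hx; apply: hv; lia.
rewrite !rd; [|by move=> x hx; rewrite /w' hx|by move=> x hx; rewrite /w hx orbT].
have -> : absz (r - l + 1)%R = (absz (r - l)%R).+1 by lia.
exact: lead_R11_diff.
Qed.

End Dependence.

Theorem theorem3p2 (R : realType) (p : R) (l r L Rb : int) :
  0 < p < 1 -> l <= r -> L < l - 1 -> r + 1 < Rb ->
  let n : nat := (absz (Num.min (l - L) (Rb - r))) in
  let N : nat := (absz (r - l + 1)) in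
  let a : R := lamr p / lamPF p in
  let bm : R := p in
  let Am : R := Num.sqrt (1 - p) / 6 in
  let bp : R := Num.max p (lamPF p) in
  let Ap : R := 24 / (1 - p) ^+ 2 in
  Am * bm ^+ N * `|a| ^+ n <= sdep p l r L Rb /\
  sdep p l r L Rb <= Ap * bp ^+ N * `|a| ^+ n.
Proof.
move=> /andP[p0 p1] lr Ll rR n N a bm Am bp Ap.
have q0 : 0 < 1 - p by rewrite subr_gt0.
pose S := [set d : R | exists w e : config, Omega' w /\ Omega' e /\
        (forall x : int, L <= x <= Rb -> w x = e x) /\
        d = `| gammaI p l r w - gammaI p l r (glue l r w e) |]%classic.
have glueE (w e : config) : (forall x : int, L <= x <= Rb -> w x = e x) ->
    glue l r w e = e.
  move=> h; apply: funext => x; rewrite /glue; case: ifP => // hx.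
  by rewrite h //; lia.
have pb : p <= bp by rewrite /bp le_max lexx.
have lb : lamPF p <= bp by rewrite /bp le_max lexx orbT.
have anti (k : nat) : (n <= k)%N -> `|a| ^+ k <= `|a| ^+ n.
  by move=> nk; rewrite -normrX; exact: (norm_ratioX_anti p0 p1).
have b0 : 0 <= bp by apply: le_trans pb; rewrite ltW.
have ub d : S d -> d <= Ap * bp ^+ N * `|a| ^+ n.
  move=> [w [e [Ow [Oe [h ->]]]]]; rewrite glueE //.
  (* The intermediate configuration differs from [w] only left of [L] and from [e] only right of
     [Rb]. *)
  pose m : config := fun x => if x < l then e x else w x.
  have mw x : L <= x -> w x = m x.
    by move=> hx; rewrite /m; case: ifP => // xl; apply: h; lia.
  have me x : x <= Rb -> m x = e x.
    by move=> hx; rewrite /m; case: ifP => // xl; apply: h; lia.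
  have Om : Omega' m.
    (* By [L < l - 1], each site and its two neighbours lie together in the range where [m] is [w]
       or in the range where it is [e]. *)
    apply/Omega'P => x; have [xl|xl] := lerP (l - 1) x.
      by rewrite -!mw; [move/Omega'P: Ow; apply|lia..].
    by rewrite !me; [move/Omega'P: Oe; apply|lia..].
  have s1 := @gamma_left_step R p p0 p1 bp l r L w m lr ltac:(lia) lb pb Ow Om mw.
  have s2 := @gamma_left_step R p p0 p1 bp (- r) (- l) (- Rb) (flip m) (flip e)
    ltac:(lia) ltac:(lia) lb pb (Omega'_flip Om) (Omega'_flip Oe).
  have {s2} := s2 ltac:(by move=> x hx; rewrite /flip me //; lia).
  rewrite !gamma_flip // (_ : absz (- l - - r + 1)%R = N); last by lia.
  move=> s2; apply: (le_trans (ler_distD (gammaI p l r m) _ _)).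
  have c0 : 0 <= 12 / (1 - p) ^+ 2 * bp ^+ N.
    by rewrite !mulr_ge0 ?exprn_ge0 ?invr_ge0 ?sqr_ge0.
  have s1' := le_trans s1 (ler_wpM2l c0 (anti _ _)).
  have s2' := le_trans s2 (ler_wpM2l c0 (anti _ _)).
  apply: (le_trans (lerD (s1' _) (s2' _))); [lia|lia|].
  rewrite -mulrDl -mulrDl -mulrDl -natrD /=; exact: lexx.
(* [sup] dominates the elements of a set only if the set is bounded, so the lower estimate also
   relies on the upper one. *)
have hub : has_ubound S by exists (Ap * bp ^+ N * `|a| ^+ n).
have elem (w e : config) : Omega' w -> Omega' e ->
    (forall x : int, L <= x <= Rb -> w x = e x) ->
    `|gammaI p l r w - gammaI p l r e| <= sdep p l r L Rb.
  move=> Ow Oe h; apply: (ub_le_sup hub); exists w, e; do 3 split=> //.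
  by rewrite glueE.
split; last first.
  apply: ge_sup => [|d /ub //].
  have O0 : Omega' (fun _ => false) by apply/Omega'P.
  by exists `|gammaI p l r (fun _ => false) - gammaI p l r (glue l r (fun _ => false) (fun _ => false))|,
    (fun _ => false), (fun _ => false).
(* The pair of configurations is placed on the side where the minimum [n] is attained. *)
have [le|le] := lerP (l - L) (Rb - r).
  have [w [e [Ow Oe h hd]]] := gamma_pair_left p0 p1 lr (ltac:(lia) : L <= l - 2).
  apply: le_trans (elem w e Ow Oe _); last by move=> x hx; apply: h; lia.
  by apply: le_trans hd; rewrite /n min_l.
have [w [e [Ow Oe h hd]]] :=
  @gamma_pair_left R p p0 p1 (- r) (- l) (- Rb) ltac:(lia) ltac:(lia).
apply: le_trans (elem (flip w) (flip e) (Omega'_flip Ow) (Omega'_flip Oe) _); last first.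
  by move=> x hx; apply: h; lia.
rewrite -(gamma_flip p (flip w) lr) -(gamma_flip p (flip e) lr) !flipK.
apply: le_trans hd; rewrite /n min_r ?(ltW le) // -/a.
rewrite (_ : absz (- l - - r + 1)%R = N); last by lia.
by rewrite (_ : absz (- r - - Rb)%R = absz (Rb - r)%R) //; lia.
Qed.
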